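(* Let $f\in H^{1/2}(\Gamma)$, and suppose that the mesh-refinement strategy satisfies (M1). Then, for each $0<\theta\le1$, the adaptive algorithm described in the context, steered by the Faermann estimator $\eta_\ell$, is convergent in the sense that $$\eta_\ell\xrightarrow{\ \ell\to\infty\ }0 ,$$ which is equivalent to $\|\phi-\Phi_\ell\|_{\widetilde H^{-1/2}(\Gamma)}\xrightarrow{\ \ell\to\infty\ }0$.
   Context: **Boundary.** $\Omega\subset\mathbb{R}^2$ is a Lipschitz domain with $\mathrm{diam}(\Omega)<1$ and $\Gamma\subseteq\partial\Omega$ is a compact, connected, piecewise smooth part of its boundary. Either $\Gamma=\partial\Omega$ (''closed'') is parametrized by a closed, continuous, piecewise twice continuously differentiable path $\gamma:[a,b]\to\Gamma$ with $\gamma|_{[a,b)}$ bijective (its $(b-a)$-periodic extension is also called $\gamma$), or $\Gamma\subsetneqq\partial\Omega$ (''open'') is parametrized by a bijective, continuous, piecewise twice continuously differentiable path $\gamma:[a,b]\to\Gamma$. The one-sided derivatives satisfy $\gamma'^{\ell}(t)\ne0$ on $(a,b]$, $\gamma'^{r}(t)\neq0$ on $[a,b)$, and $\gamma'^{\ell}(t)+c\,\gamma'^{r}(t)\ne0$ for all $c>0$ and all $t\in[a,b]$ (closed) resp. $t\in(a,b)$ (open). Integrals on $\Gamma$ are with respect to arclength; $|\cdot|$ denotes length of intervals, arclength, and cardinality. **Spaces and integral equation.** For measurable $\Gamma_0\subseteq\Gamma$, $|u|_{H^{1/2}(\Gamma_0)}^2=\int_{\Gamma_0}\int_{\Gamma_0}\frac{|u(x)-u(y)|^2}{|x-y|^{2}}\,dy\,dx$;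 $H^{1/2}(\Gamma)$ is the space of $u\in L^2(\Gamma)$ with finite norm $\|u\|_{H^{1/2}(\Gamma)}^2=\|u\|_{L^2(\Gamma)}^2+|u|_{H^{1/2}(\Gamma)}^2$. $\widetilde H^{-1/2}(\Gamma)$ is its dual with respect to the extended $L^2(\Gamma)$ scalar product $\langle\cdot\,;\cdot\rangle_\Gamma$. The operator $V\phi(x)=-\frac1{2\pi}\int_\Gamma\log|x-y|\,\phi(y)\,dy$ is a symmetric elliptic isomorphism $\widetilde H^{-1/2}(\Gamma)\to H^{1/2}(\Gamma)$. $\phi\in\widetilde H^{-1/2}(\Gamma)$ is the unique solution of $V\phi=f$. **Meshes.** Fix $p\in\mathbb{N}_0$. A mesh $[\mathcal T_\star]$ consists of parameters $a=\check z_0<\dots<\check z_n=b$ with $\gamma|_{[\check z_{j-1},\check z_j]}\in C^2$, nodes $z_j=\gamma(\check z_j)$ (node set $\mathcal N_\star=\{z_1,\dots,z_n\}$, $z_0=z_n$, if closed; $\mathcal N_\star=\{z_0,\dots,z_n\}$ if open), and multiplicities $\#z_j\in\{1,\dots,p+1\}$ with $\#z_0=\#z_n=p+1$. The knots $\mathcal K_\star$ are the tuple $(z_k,\dots,z_k,\dots,z_n,\dots,z_n)$, each $z_j$ repeated $\#z_j$ times, $k=1$ (closed) resp. $k=0$ (open); $\check{\mathcal K}_\star$ is the corresponding tuple in the parameter domain ($(a,b]$ if closed, $[a,b]$ if open). The elements are $T_j=\gamma([\check z_{j-1},\check z_j])$, $\mathcal T_\star=\{T_1,\dots,T_n\}$,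 $[T]:=(T,\#z_{T,1},\#z_{T,2})$ with $z_{T,1},z_{T,2}$ the two end nodes of $T$, and $[\mathcal T_\star]=\{[T]:T\in\mathcal T_\star\}$. Put $\check h_{\star,T}=|\gamma^{-1}(T)|$ and $\check\kappa_\star=\max\{\check h_{\star,T}/\check h_{\star,T'}:T,T'\in\mathcal T_\star,\ T\cap T'\ne\emptyset\}$. For $z\in\mathcal N_\star$, $\omega_\star(z)=\bigcup\{T\in\mathcal T_\star:z\in T\}$. For $\mathcal U\subseteq[\mathcal T_\star]$, $\bigcup\mathcal U=\bigcup\{T:[T]\in\mathcal U\}$. **Refinement.** $\mathtt{ref}(\cdot)$ is a deterministic strategy assigning to a mesh $[\mathcal T_\star]$ and a set $\mathcal M_\star\subseteq\mathcal N_\star$ of marked nodes a mesh $[\mathcal T_+]=\mathtt{ref}([\mathcal T_\star],\mathcal M_\star)$ such that $\mathcal M_\star\subset\bigcup([\mathcal T_\star]\setminus[\mathcal T_+])$ and $\mathcal K_\star$ is a subsequence of $\mathcal K_+$. $\mathtt{ref}([\mathcal T_\star])$ is the set of all meshes obtained from $[\mathcal T_\star]$ by finitely many (possibly zero) such steps with arbitrary marked sets. Fix an initial mesh $[\mathcal T_0]$ (with $|T|\le|\Gamma|/4$ for all $T\in\mathcal T_0$ if $\Gamma$ is closed) and put $[\mathbb T]=\mathtt{ref}([\mathcal T_0])$. Assumption (M1): there is $\check\kappa_{\max}\ge1$ with $\check\kappa_\star\le\check\kappa_{\max}$ for all $[\mathcal T_\star]\in[\mathbb T]$. **Ansatz spaces.**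 Write $\check{\mathcal K}_0=(t_i)_{i=1}^N$ with $t_{-p}=\dots=t_0:=a$ added (closed) resp. $\check{\mathcal K}_0=(t_i)_{i=-p}^N$ (open), extended arbitrarily to a nondecreasing sequence $(t_i)_{i\in\mathbb Z}$ with $t_i\to\pm\infty$ as $i\to\pm\infty$. $B_{i,p}$ denotes the degree-$p$ B-splines given by $B_{i,0}=\chi_{[t_{i-1},t_i)}$, $B_{i,p}=\beta_{i-1,p}B_{i,p-1}+(1-\beta_{i,p})B_{i+1,p-1}$, $\beta_{i,p}(t)=\frac{t-t_i}{t_{i+p}-t_i}$ if $t_i\ne t_{i+p}$ and $0$ otherwise. Given initial weights $\mathcal W_0=(w_i)_{i=1-p}^{N-p}$, $w_i>0$, put $w=\sum_{i=1-p}^{N-p}w_iB_{i,p}$ on $[a,b)$. For $[\mathcal T_\star]\in[\mathbb T]$, $\mathcal X_\star\subset L^2(\Gamma)$ is the space of all functions $(S/w)\circ\gamma|_{[a,b)}^{-1}$, where $S$ is a linear combination of the degree-$p$ B-splines with respect to $\check{\mathcal K}_\star$ (extended in the same way). (Equivalently: NURBS with knots $\check{\mathcal K}_\star$ and the weights obtained from $\mathcal W_0$ by knot insertion, so that the denominator remains $w$.) $\Phi_\star\in\mathcal X_\star$ is the Galerkin solution: $\langle V\Phi_\star;\Psi_\star\rangle_\Gamma=\langle f;\Psi_\star\rangle_\Gamma$ for all $\Psi_\star\in\mathcal X_\star$. **Faermann estimator.** $\eta_\star^2=\sum_{z\in\mathcal N_\star}\eta_\star(z)^2$ with $\eta_\star(z)^2=|f-V\Phi_\star|_{H^{1/2}(\omega_\star(z))}^2$.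 It is known that $C_{\rm eff}^{-1}\eta_\star\le\|\phi-\Phi_\star\|_{\widetilde H^{-1/2}(\Gamma)}\le C_{\rm rel}\,\eta_\star$ with constants $C_{\rm eff},C_{\rm rel}>0$ independent of $[\mathcal T_\star]\in[\mathbb T]$. **Adaptive algorithm.** Input: $\theta$, $C_{\rm mark}\ge1$, $p$, $[\mathcal T_0]$, $\mathcal W_0$. For $\ell=0,1,2,\dots$: (i) compute $\Phi_\ell\in\mathcal X_\ell$; (ii) compute $\eta_\ell(z)$ for all $z\in\mathcal N_\ell$; (iii) choose $\mathcal M_\ell\subseteq\mathcal N_\ell$ with $\theta\eta_\ell^2\le\sum_{z\in\mathcal M_\ell}\eta_\ell(z)^2$ whose cardinality is, up to the factor $C_{\rm mark}$, minimal among all sets with this property; (iv) set $[\mathcal T_{\ell+1}]=\mathtt{ref}([\mathcal T_\ell],\mathcal M_\ell)$. *)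

(* Defs.v *)
From HB Require Import structures.
From mathcomp Require Import all_boot all_order all_algebra finmap.
From mathcomp Require Import all_classical all_reals all_analysis.

Set Implicit Arguments.
Unset Strict Implicit.
Unset Printing Implicit Defensive.

Import Order.TTheory GRing.Theory Num.Theory.
Import numFieldNormedType.Exports.

Local Open Scope classical_set_scope.
Local Open Scope ring_scope.

(* The library norm on [R * R] is the maximum norm, hence the explicit
   Euclidean one; both induce the product topology used for [open], [closure]
   and continuity. *)
Section plane.
Context {R : realType}.
Implicit Types (x y : R * R) (A : set (R * R)).

Definition enorm x : R := Num.sqrt (x.1 ^+ 2 + x.2 ^+ 2).

Definition edist x y : R := enorm (x - y).

Definition diam A : \bar R := ereal_sup [set (edist x y)%:E | x in A & y in A].

Definition boundary A : set (R * R) := closure A `\` A°.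

(* Around every boundary point [x], in the orthonormal frame obtained by
   rotating by the angle with cosine [c] and sine [s], the set is the part of
   a rectangle that lies strictly above a Lipschitz graph. *)
Definition lipschitz_boundary A : Prop :=
  forall x, boundary A x ->
  exists c s r h L : R, exists g : R -> R,
    [/\ c ^+ 2 + s ^+ 2 = 1, 0 < r, 0 < h,
        (forall u v, `|g u - g v| <= L * `|u - v|) &
        forall u v, `|u| < r -> `|v| < h ->
          A (x.1 + u * c - v * s, x.2 + u * s + v * c) <-> g u < v].

Definition lipschitz_domain A : Prop :=
  [/\ A !=set0, open A, connected A & lipschitz_boundary A].

(* The one-sided derivatives $\gamma'^\ell$ and $\gamma'^r$. *)
Definition lder (g : R -> R * R) (t : R) : R * R :=
  (lim ((fun h => ((g (t + h)).1 - (g t).1) / h) @ (0 : R)^'-),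
   lim ((fun h => ((g (t + h)).2 - (g t).2) / h) @ (0 : R)^'-)).

Definition rder (g : R -> R * R) (t : R) : R * R :=
  (lim ((fun h => ((g (t + h)).1 - (g t).1) / h) @ (0 : R)^'+),
   lim ((fun h => ((g (t + h)).2 - (g t).2) / h) @ (0 : R)^'+)).

Definition C2 (g : R -> R) : Prop :=
  [/\ forall t, derivable g t 1, forall t, derivable (derive1 g) t 1 &
      continuous (derive1n 2 g)].

(* C^2 up to the end points of [c, d], as restriction of a C^2 function. *)
Definition C2_on (g : R -> R) (c d : R) : Prop :=
  exists2 k : R -> R, C2 k & {in `[c, d], k =1 g}.

Definition C2_between (g : R -> R * R) (s : seq R) : Prop :=
  forall i, (i.+1 < size s)%N ->
    C2_on (fun t => (g t).1) s`_i s`_i.+1 /\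
    C2_on (fun t => (g t).2) s`_i s`_i.+1.

End plane.

(* A parametrization [cfun] on [ca, cb]; [cclosed] distinguishes the closed
   case $\Gamma = \partial\Omega$ from the open case
   $\Gamma \subsetneqq \partial\Omega$. *)
Record curve (R : realType) := Curve {
  cfun :> R -> R * R;
  ca : R;
  cb : R;
  cclosed : bool }.

Section curves.
Context {R : realType} (G : curve R).
Local Notation a := (ca G).
Local Notation b := (cb G).
Local Notation mu := (@lebesgue_measure R).
Implicit Types (E : set (R * R)) (u v : R * R -> R).

Definition Gam : set (R * R) := G @` `[a, b].

(* The (b - a)-periodic extension, in the closed case. *)
Definition cext (t : R) : R * R :=
  if cclosed G
  then G (t - (Num.floor ((t - a) / (b - a)))%:~R * (b - a)) else G t.

Definition boundary_curve (Omega : set (R * R)) : Prop :=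
  [/\ a < b,
      {within `[a, b], continuous G},
      (exists s : seq R,
         [/\ path <%R a s, last a s = b & C2_between G (a :: s)]),
      (if cclosed G
       then [/\ Gam = boundary Omega, G a = G b & set_bij `[a, b[ Gam G]
       else (Gam `<` boundary Omega) /\ set_bij `[a, b] Gam G) &
      [/\ {in `]a, b], forall t, lder cext t <> 0},
          {in `[a, b[, forall t, rder cext t <> 0} &
          forall t c : R, 0 < c ->
            (if cclosed G then t \in `[a, b] else t \in `]a, b[) ->
            ((lder cext t).1 + c * (rder cext t).1,
             (lder cext t).2 + c * (rder cext t).2) <> (0, 0)]].

Definition speed (t : R) : R := enorm (rder cext t).

(* Integral over [E `&` Gam] with respect to arclength. *)
Definition arcint E (g : R * R -> \bar R) : \bar R :=
  (\int[mu]_(t in `[a, b] `&` G @^-1` E) (g (G t) * (speed t)%:E))%E.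

Definition arclen E : \bar R := arcint E (fun=> 1%E).

Definition aeq u v : Prop :=
  {ae mu, forall t : R, t \in `[a, b] -> u (G t) = v (G t)}.

(* Functions on Gamma are represented by functions on the plane, of which only
   the values on Gamma matter. *)
Definition normL2sq u : \bar R := arcint Gam (fun x => (u x ^+ 2)%:E).

Definition L2 u : Prop :=
  measurable_fun `[a, b] (u \o G) /\ (normL2sq u < +oo)%E.

Definition semisq E u : \bar R :=
  arcint E (fun x => arcint E (fun y =>
    ((u x - u y) ^+ 2 / edist x y ^+ 2)%:E)).

Definition H12 u : Prop := L2 u /\ (semisq Gam u < +oo)%E.

Definition normH12 u : R :=
  Num.sqrt (fine (normL2sq u + semisq Gam u)%E).

(* The dual space of H^{1/2}(Gamma); only the values of a functional on
   H^{1/2}(Gamma) matter. *)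
Definition dual (psi : (R * R -> R) -> R) : Prop :=
  (forall (c : R) u v, H12 u -> H12 v ->
     psi (fun x => c * u x + v x) = c * psi u + psi v) /\
  exists C : R, forall u, H12 u -> `|psi u| <= C * normH12 u.

Definition dnorm (psi : (R * R -> R) -> R) : R :=
  sup [set r | exists u, [/\ H12 u, normH12 u <= 1 & r = `|psi u|]].

(* The L^2 scalar product; [ip Psi] is Psi seen as an element of the dual. *)
Definition ip (Psi u : R * R -> R) : R :=
  fine (arcint Gam (fun x => (Psi x * u x)%:E)).

Definition slp (psi : R * R -> R) (x : R * R) : R :=
  - (2 * pi)^-1 *
  fine (arcint Gam (fun y => (ln (edist x y) * psi y)%:E)).

(* [V] is the single-layer operator from the dual of H^{1/2} to H^{1/2}: the
   integral formula makes sense for densities in L^2(Gamma), a dense subspace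
   of the dual, and [V] is its bounded linear extension (unique almost
   everywhere). *)
Definition single_layer (V : ((R * R -> R) -> R) -> R * R -> R) : Prop :=
  [/\ forall psi, dual psi -> H12 (V psi),
      forall (c : R) psi chi, dual psi -> dual chi ->
        aeq (V (fun u => c * psi u + chi u)) (fun x => c * V psi x + V chi x),
      exists C : R, forall psi, dual psi -> normH12 (V psi) <= C * dnorm psi &
      forall Psi, L2 Psi -> aeq (V (ip Psi)) (slp Psi)].

Definition symmetric_elliptic_isomorphism
    (V : ((R * R -> R) -> R) -> R * R -> R) : Prop :=
  [/\ forall psi chi, dual psi -> dual chi -> psi (V chi) = chi (V psi),
      (exists2 c : R, 0 < c &
         forall psi, dual psi -> c * dnorm psi ^+ 2 <= psi (V psi)),
      (exists C : R, forall psi, dual psi -> dnorm psi <= C * normH12 (V psi)) &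
      forall u, H12 u -> exists2 psi, dual psi & aeq (V psi) u].

End curves.

(* The mesh with parameters z_0 < ... < z_n and multiplicities m_0, ..., m_n is
   the list of pairs (z_0, m_0), ..., (z_n, m_n). *)
Definition mesh (R : realType) := seq (R * nat).

Section meshes.
Context {R : realType} (G : curve R) (p : nat).
Local Notation a := (ca G).
Local Notation b := (cb G).
Local Notation mu := (@lebesgue_measure R).
Implicit Types (T : mesh R) (E : set (R * R)).

Definition zpar T (j : nat) : R := nth 0 (unzip1 T) j.

Definition mult T (j : nat) : nat := nth 0%N (unzip2 T) j.

Definition ncells T : nat := (size T).-1.

Definition is_mesh T : Prop :=
  [/\ (0 < ncells T)%N,
      sorted <%R (unzip1 T) /\ C2_between G (unzip1 T),
      zpar T 0 = a /\ zpar T (ncells T) = b,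
      forall j, (j <= ncells T)%N -> (1 <= mult T j <= p.+1)%N &
      mult T 0 = p.+1 /\ mult T (ncells T) = p.+1].

(* In the closed case z_0 = z_n is listed once. *)
Definition nodes T : {fset R * R} :=
  [fset z in [seq G t | t <- drop (cclosed G) (unzip1 T)]]%fset.

Definition knots T : seq (R * R) :=
  flatten [seq nseq zm.2 (G zm.1) | zm <- drop (cclosed G) T].

Definition elt T (j : nat) : set (R * R) :=
  G @` `[zpar T j, zpar T j.+1].

Definition elts T : set (set (R * R)) :=
  [set elt T j | j in [set j | (j < ncells T)%N]].

(* The set [T] of elements together with the multiplicities of their end
   nodes. *)
Definition belts T : set (set (R * R) * nat * nat) :=
  [set (elt T j, mult T j, mult T j.+1) | j in [set j | (j < ncells T)%N]].

Definition cover (U : set (set (R * R) * nat * nat)) : set (R * R) :=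
  \bigcup_(e in U) e.1.1.

Definition patch T (z : R * R) : set (R * R) :=
  \bigcup_(E in [set E | elts T E /\ E z]) E.

Definition hpar E : R := fine (mu (`[a, b] `&` G @^-1` E)).

Definition kappa T : R :=
  sup [set r | exists E E', [/\ elts T E, elts T E', E `&` E' !=set0 &
                               r = hpar E / hpar E']].

Definition refinement_strategy (ref : mesh R -> {fset R * R} -> mesh R) :=
  forall T (M : {fset R * R}), is_mesh T -> (M `<=` nodes T)%fset ->
    [/\ is_mesh (ref T M),
        [set` M] `<=` cover (belts T `\` belts (ref T M)) &
        subseq (knots T) (knots (ref T M))].

Inductive refs (ref : mesh R -> {fset R * R} -> mesh R) (T : mesh R) :
    mesh R -> Prop :=
| refs_refl : refs ref T T
| refs_step T' M : refs ref T T' -> (M `<=` nodes T')%fset ->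
    refs ref T (ref T' M).

Definition M1 (ref : mesh R -> {fset R * R} -> mesh R) (T0 : mesh R) : Prop :=
  exists2 kmax : R, 1 <= kmax & forall T, refs ref T0 T -> kappa T <= kmax.

(* The knots t_{-p}, ..., t_N in the parameter domain. Since #z_0 = p + 1, in
   the closed case the p + 1 added knots a are the copies of z_0. *)
Definition pknots T : seq R := flatten [seq nseq zm.2 zm.1 | zm <- T].

Definition Ndim T : nat := size (pknots T) - p.+1.

(* t_i for i in Z, continued with unit steps to the left of t_{-p} and to the
   right of t_N; the B-splines on [a, b) do not depend on this choice. *)
Definition tknot T (i : int) : R :=
  match i + p%:Z with
  | Posz k => if (k < size (pknots T))%N then (pknots T)`_k
              else b + (k - size (pknots T)).+1%:R
  | Negz k => a - k.+1%:R
  end.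

Definition bbeta (t : int -> R) (i : int) (q : nat) (x : R) : R :=
  if t i == t (i + q%:Z) then 0 else (x - t i) / (t (i + q%:Z) - t i).

Fixpoint bspline (t : int -> R) (q : nat) (i : int) (x : R) : R :=
  match q with
  | 0%N => if t (i - 1) <= x < t i then 1 else 0
  | q'.+1 => bbeta t (i - 1) q x * bspline t q' i x +
             (1 - bbeta t i q x) * bspline t q' (i + 1) x
  end.

(* $\sum_{i=1-p}^{N-p} c_i B_{i,p}$; the other B-splines vanish on [a, b). *)
Definition spline T (c : int -> R) (x : R) : R :=
  \sum_(j < Ndim T)
     c (1 - p%:Z + j%:Z) * bspline (tknot T) p (1 - p%:Z + j%:Z) x.

Definition positive_weights T0 (W0 : int -> R) : Prop :=
  forall i : int, 1 - p%:Z <= i <= (Ndim T0)%:Z - p%:Z -> 0 < W0 i.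

Definition ansatz T0 (W0 : int -> R) T : set (R * R -> R) :=
  [set Psi | exists c : int -> R, forall t : R, t \in `[a, b[ ->
     Psi (G t) = spline T c t / spline T0 W0 t].

End meshes.

Section adaptive.
Context {R : realType} (G : curve R) (p : nat).
Context (V : ((R * R -> R) -> R) -> R * R -> R) (f : R * R -> R).
Implicit Types (T : mesh R) (Phi : R * R -> R).

Definition galerkin T0 (W0 : int -> R) T Phi : Prop :=
  ansatz G p T0 W0 T Phi /\
  forall Psi, ansatz G p T0 W0 T Psi ->
    ip G (V (ip G Phi)) Psi = ip G f Psi.

(* Taking [fine] is harmless: the residual f - V Phi lies in H^{1/2}(Gamma). *)
Definition etasq T Phi (z : R * R) : R :=
  fine (semisq G (patch G T z) (fun x => f x - V (ip G Phi) x)).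

Definition eta T Phi : R := Num.sqrt (\sum_(z <- nodes G T) etasq T Phi z).

Definition doerfler (theta : R) T Phi (M : {fset R * R}) : Prop :=
  (M `<=` nodes G T)%fset /\
  theta * eta T Phi ^+ 2 <= \sum_(z <- M) etasq T Phi z.

Definition err (phi : (R * R -> R) -> R) Phi : R :=
  dnorm G (fun u => phi u - ip G Phi u).

Definition reliable_efficient ref T0 (W0 : int -> R)
    (phi : (R * R -> R) -> R) : Prop :=
  exists Ceff Crel : R, [/\ 0 < Ceff, 0 < Crel &
    forall T Phi, refs G ref T0 T -> galerkin T0 W0 T Phi ->
      Ceff^-1 * eta T Phi <= err phi Phi <= Crel * eta T Phi].

Record adaptive_run ref T0 (W0 : int -> R) (theta Cmark : R)
    (T : nat -> mesh R) (Phi : nat -> R * R -> R)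
    (M : nat -> {fset R * R}) : Prop := AdaptiveRun {
  run_init : T 0%N = T0;
  run_solve : forall l, galerkin T0 W0 (T l) (Phi l);
  run_mark : forall l, doerfler theta (T l) (Phi l) (M l);
  run_mark_min : forall l (M' : {fset R * R}),
    doerfler theta (T l) (Phi l) M' -> #|` M l|%:R <= Cmark * #|` M'|%:R;
  run_refine : forall l, T l.+1 = ref (T l) (M l) }.

End adaptive.

(* Main.v *)
Require Import Defs.
From mathcomp Require Import all_boot all_order all_algebra finmap.
From mathcomp Require Import all_classical all_reals all_analysis.
From mathcomp Require Import measurable_realfun zify ring lra.
Import Order.TTheory GRing.Theory Num.Theory.
Import numFieldNormedType.Exports.
Set Implicit Arguments.
Unset Strict Implicit.
Unset Printing Implicit Defensive.
Local Open Scope classical_set_scope.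
Local Open Scope ring_scope.

(** The proof rests on two monotone quantities and needs neither an inverse
    estimate nor any property of the boundary beyond the parametrization.

    The residuals [r_l = f - V Phi_l] form a Cauchy sequence in H^{1/2}.  A
    refined mesh has a larger spline space ([splinespace_subseq], by inserting
    one knot after the other), and the weight function stays the same, so the
    ansatz spaces are nested ([ansatz_subseq]).  Hence [J_l = <f; Phi_l>], the
    squared energy norm of [Phi_l], satisfies [J_m - J_l = |Phi_m - Phi_l|^2]
    in the energy norm for [l <= m] and is bounded by the squared energy norm
    of the exact solution.  So [J_l] converges, and ellipticity and boundedness
    of [V] carry the Cauchy property over to the residuals
    ([run_resid_cauchy]).

    The patches of the marked nodes shrink.  Let [h] run through the lengths
    of the cells in the parameter domain, and [m], [m'] be the multiplicities
    at the ends of the cell.  By [M1], the pieces of a split cell are shorter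
    than the cell by a fixed factor, so that the sum of [h^2 * (C - m - m')]
    over all cells is nonincreasing for large [C] and drops at least by a fixed
    multiple of [h^2] for every cell that is split or has a multiplicity raised
    ([pot_refine]).
    Being bounded below, it converges, so the cells that are changed in step
    [l] have a length tending to [0].  The patch of a marked node contains such
    a cell, and any other cell of the patch has comparable length, again by
    [M1]; uniform continuity of the parametrization gives that the diameters of
    these patches on the curve tend to [0] ([run_patch_small]).

    Now fix [L] and let [l >= L].  By the marking criterion,
    [theta * eta_l^2] is at most the sum of [|r_l|^2] over the marked patches,
    thus at most twice the corresponding sums for [r_l - r_L] and for [r_L].
    Almost every point lies in at most two patches ([patch_overlap]), hence
    the former is at most [2 |r_l - r_L|^2], which is small if [L] is large, and
    the latter is at most twice the part of the double integral [|r_L|^2] over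
    pairs of points at small distance ([sum_kint_near]), which tends to [0] by
    dominated convergence ([cvg_nint]).  So [eta_l] tends to [0], and the
    equivalence with convergence of the error is reliability and efficiency. *)

(** * Preliminaries *)

(* [lia] on the hypotheses about natural numbers only. *)
Ltac nlia := repeat match goal with
  | H : ?T |- _ => lazymatch T with
    | is_true (leq _ _) => fail
    | is_true (leq _ _ && leq _ _) => fail
    | @eq nat _ _ => fail
    | nat => fail
    | _ => clear H
    end
  end; lia.

Lemma measurable_invr (R : realType) : measurable_fun [set: R] (@GRing.inv R).
Proof.
have m1 : measurable [set x : R | x != 0].
  rewrite [X in measurable X](_ : _ = ~` [set 0]); first exact: measurableC.
  by apply/seteqP; split => x /= /eqP.
rewrite -(setUv [set x : R | x != 0]); apply/measurable_funU => //.
  exact: measurableC.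
split.
  apply: open_continuous_measurable_fun; last first.
    by move=> x; rewrite inE; exact: inv_continuous.
  rewrite [X in open X](_ : _ = ~` [set 0]); first exact/closed_openC/closed_eq.
  by apply/seteqP; split => x /= /eqP.
rewrite [X in measurable_fun X](_ : _ = [set 0]); first exact: measurable_fun_set1.
apply/seteqP; split => x /=; first by move/negP; rewrite negbK => /eqP.
by move=> ->; rewrite eqxx.
Qed.

(** * B-splines and knot insertion *)
Section msplines.
Context {R : realType}.
Implicit Types (tau : nat -> R) (u : seq R) (x s : R).

(** The B-spline of degree [q] with knots [tau j <= ... <= tau (j + q.+1)],
    divided by the length of its knot interval; it is [0] when that interval
    is degenerate because division by [0] yields [0]. *)
Fixpoint mspline tau (q j : nat) x : R :=
  match q with
  | 0 => if tau j <= x < tau j.+1 then (tau j.+1 - tau j)^-1 else 0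
  | q'.+1 => ((x - tau j) * mspline tau q' j x +
              (tau (j + q'.+2)%N - x) * mspline tau q' j.+1 x) /
             (tau (j + q'.+2)%N - tau j)
  end.

(** The B-spline of [bspline], for a knot sequence indexed by natural
    numbers (see [bspline_nspline]). *)
Definition nspline tau (q j : nat) x : R :=
  (tau (j + q.+1)%N - tau j) * mspline tau q j x.

Lemma mspline_deg tau q j x : tau (j + q.+1)%N = tau j -> mspline tau q j x = 0.
Proof.
case: q => [|q] /=; last by move=> ->; rewrite subrr invr0 mulr0.
rewrite addn1 => ->; case: ifP => // /andP[h1 h2].
by have := le_lt_trans h1 h2; rewrite ltxx.
Qed.

Lemma eq_mspline tau tau' q j j' x :
  (forall k, (k <= q.+1)%N -> tau (j + k)%N = tau' (j' + k)%N) ->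
  mspline tau q j x = mspline tau' q j' x.
Proof.
elim: q j j' => [|q IH] j j' h /=.
  by have := h 0%N isT; have := h 1%N isT; rewrite !addn1 !addn0 => -> ->.
rewrite (IH j j'); last by move=> k kq; apply: h; nlia.
rewrite (IH j.+1 j'.+1); last by move=> k kq; rewrite !addSnnS; apply: h; nlia.
by rewrite (h q.+2) //; have := h 0%N isT; rewrite !addn0 => ->.
Qed.

(** [tau] is nondecreasing on the indices from [lo] to [hi]. *)
Definition nondec tau (lo hi : nat) :=
  forall k l, (lo <= k)%N -> (k <= l)%N -> (l <= hi)%N -> tau k <= tau l.

Lemma nondec_sub tau lo hi lo' hi' : (lo <= lo')%N -> (hi' <= hi)%N ->
  nondec tau lo hi -> nondec tau lo' hi'.
Proof. by move=> h1 h2 h k l hk kl lh; apply: h => //; nlia. Qed.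

Lemma nondec_mspline_deg tau lo hi q j x : nondec tau lo hi ->
  tau lo = tau hi -> (lo <= j)%N -> (j + q.+1 <= hi)%N ->
  mspline tau q j x = 0.
Proof.
move=> h e h1 h2; apply: mspline_deg; apply/eqP; rewrite eq_le.
apply/andP; split; last by apply: h; nlia.
by apply: (@le_trans _ _ (tau hi)); [apply: h; nlia | rewrite -e; apply: h; nlia].
Qed.

(** When the knot interval is degenerate, so are the two knot intervals on the
   right-hand side. *)
Lemma nsplineS tau q j x : nondec tau j (j + q.+2)%N ->
  nspline tau q.+1 j x = (x - tau j) * mspline tau q j x +
    (tau (j + q.+2)%N - x) * mspline tau q j.+1 x.
Proof.
move=> h; rewrite /nspline /=.
have [e|ne] := eqVneq (tau (j + q.+2)%N) (tau j); last first.
  by field; rewrite subr_eq0.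
by rewrite !(nondec_mspline_deg _ h) ?e //; first ring; nlia.
Qed.

(** A vanishing denominator in [bbeta] comes with a vanishing B-spline of
    lower degree. *)
Lemma bspline_nspline (t : int -> R) tau q (i : int) j x :
  nondec tau j (j + q.+1)%N ->
  (forall k, (k <= q.+1)%N -> t (i - 1 + k%:Z) = tau (j + k)%N) ->
  bspline t q i x = nspline tau q j x.
Proof.
elim: q i j => [|q IH] i j nd h.
  have := h 0%N isT; have := h 1%N isT; rewrite addr0 subrK addn0 addn1.
  rewrite /nspline /= addn1 => -> ->; case: ifP => [/andP[h1 h2]|]; last by rewrite mulr0.
  by rewrite mulfV // subr_eq0 gt_eqF // (le_lt_trans h1 h2).
rewrite [LHS]/= /bbeta.
rewrite (IH i j); last 2 first.
- by apply: nondec_sub nd; nlia.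
- by move=> k kq; apply: h; nlia.
rewrite (IH (i + 1) j.+1); last 2 first.
- by apply: nondec_sub nd; nlia.
- by move=> k kq; rewrite addSnnS -h; [congr (t _); nlia|nlia].
have -> : t (i - 1) = tau j by have := h 0%N isT; rewrite addn0 addr0.
have -> : t (i - 1 + q.+1%:Z) = tau (j + q.+1)%N by apply: h; nlia.
have -> : t i = tau j.+1 by have := h 1%N isT; rewrite addn1 subrK.
have -> : t (i + q.+1%:Z) = tau (j + q.+2)%N.
  by rewrite -h; [congr (t _); nlia|nlia].
rewrite nsplineS // /nspline addSnnS; congr (_ + _).
  have [e|ne] := eqVneq; last by field; rewrite subr_eq0 eq_sym.
  by rewrite mspline_deg ?mulr0.
have [e|ne] := eqVneq; last by field; rewrite subr_eq0 eq_sym.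
by rewrite mspline_deg ?mulr0 // addSnnS.
Qed.

Lemma mspline_ge0 tau q j x : nondec tau j (j + q.+1)%N -> 0 <= mspline tau q j x.
Proof.
(* The induction needs the support as well. *)
suff: nondec tau j (j + q.+1)%N -> 0 <= mspline tau q j x /\
    (mspline tau q j x != 0 -> tau j <= x < tau (j + q.+1)%N).
  by move=> h /h[].
elim: q j => [|q IH] j nd.
  rewrite /= addn1; case: ifP => [/andP[h1 h2]|]; last by rewrite eqxx.
  by rewrite invr_ge0 subr_ge0 (ltW (le_lt_trans h1 h2)).
have [|p1 s1] := IH j; first by apply: nondec_sub nd; nlia.
have [|p2 s2] := IH j.+1; first by apply: nondec_sub nd; nlia.
have le1 : tau j <= tau j.+1 by apply: nd; nlia.
have le2 : tau (j + q.+1)%N <= tau (j + q.+2)%N by apply: nd; nlia.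
rewrite addSnnS in s2.
have g1 : 0 <= (x - tau j) * mspline tau q j x.
  have [->|/s1/andP[h1 h2]] := eqVneq (mspline tau q j x) 0; first by rewrite mulr0.
  by rewrite mulr_ge0 // subr_ge0.
have g2 : 0 <= (tau (j + q.+2)%N - x) * mspline tau q j.+1 x.
  have [->|/s2/andP[h1 h2]] := eqVneq (mspline tau q j.+1 x) 0; first by rewrite mulr0.
  by rewrite mulr_ge0 // subr_ge0 ltW.
split=> /=.
  by apply: divr_ge0; [exact: addr_ge0 | rewrite subr_ge0; apply: nd; nlia].
have [e1|/s1/andP[h1 h2]] := eqVneq (mspline tau q j x) 0; last first.
  by rewrite h1 (lt_le_trans h2).
have [e2|/s2/andP[h1 h2]] := eqVneq (mspline tau q j.+1 x) 0; last first.
  by rewrite h2 (le_trans _ h1).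
by rewrite e1 e2 !mulr0 addr0 mul0r eqxx.
Qed.

Lemma nspline_ge0 tau q j x : nondec tau j (j + q.+1)%N -> 0 <= nspline tau q j x.
Proof.
by move=> nd; rewrite mulr_ge0 ?mspline_ge0 // subr_ge0; apply: nd; nlia.
Qed.

(** Partition of unity: with [q.+1] equal knots at both ends, summing the
    recursion gives a telescoping sum whose two boundary terms are
    degenerate. *)
Lemma sum_nspline tau p n x : nondec tau 0 (n + p)%N ->
  tau 0%N = tau p -> tau n = tau (n + p)%N ->
  tau 0%N <= x < tau (n + p)%N -> \sum_(j < n) nspline tau p j x = 1.
Proof.
move=> nd e0 en xin.
suff h q d : (q + d)%N = p -> \sum_(0 <= j < n + d) nspline tau q j x = 1.
  by have := h p 0%N (addn0 _); rewrite addn0 big_mkord.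
elim: q d => [|q IH] d eqd.
  move: eqd; rewrite add0n => ->.
  have E j : (j < n + p)%N -> nspline tau 0 j x =
      (tau j <= x)%R%:R - (tau j.+1 <= x)%R%:R.
    move=> jn; rewrite /nspline /= addn1.
    have le1 : tau j <= tau j.+1 by apply: nd; nlia.
    have [h1|h1] := leP (tau j) x; have [h2|h2] := ltP x (tau j.+1); rewrite /=.
    - by rewrite mulfV ?subr0 // subr_eq0 gt_eqF // (le_lt_trans h1).
    - by rewrite mulr0 subrr.
    - by rewrite mulr0 subrr.
    - by rewrite leNgt (le_lt_trans h2 h1) in le1.
  rewrite (eq_big_nat _ _
    (F2 := fun j => (tau j <= x)%R%:R - (tau j.+1 <= x)%R%:R)); last first.
    by move=> j /andP[_ jn]; exact: E.
  rewrite -[LHS]opprK -sumrN.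
  under eq_bigr do rewrite opprB.
  rewrite telescope_sumr // opprB; move/andP: xin => [-> h].
  by rewrite leNgt h subr0.
rewrite -(IH d.+1); last by nlia.
rewrite (eq_big_nat _ _ (F2 := fun j => (x - tau j) * mspline tau q j x +
    (tau (j.+1 + q.+1)%N - x) * mspline tau q j.+1 x)); last first.
  move=> j /andP[_ jn]; rewrite nsplineS; first by rewrite addSnnS.
  by apply: nondec_sub nd; nlia.
rewrite big_split /=.
have z0 : mspline tau q 0 x = 0.
  apply: (@nondec_mspline_deg _ 0 p) => //; last by nlia.
  by apply: nondec_sub nd; nlia.
have zn : mspline tau q (n + d) x = 0.
  apply: (@nondec_mspline_deg _ n (n + p)%N) => //; try by nlia.
  by apply: nondec_sub nd; nlia.
rewrite addnS.
have -> : \sum_(0 <= i < n + d) (x - tau i) * mspline tau q i x =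
   \sum_(0 <= i < (n + d).+1) (x - tau i) * mspline tau q i x.
  by rewrite big_nat_recr //= zn mulr0 addr0.
have -> : \sum_(0 <= i < n + d) (tau (i.+1 + q.+1)%N - x) * mspline tau q i.+1 x =
   \sum_(0 <= i < (n + d).+1) (tau (i + q.+1)%N - x) * mspline tau q i x.
  by rewrite big_nat_recl // z0 mulr0 add0r.
rewrite -big_split /=; apply: eq_bigr => i _; rewrite /nspline; ring.
Qed.

(** The sequence [tau] with [s] inserted at position [k]. *)
Definition insknot tau k s (i : nat) : R :=
  if (i < k)%N then tau i else if i == k then s else tau i.-1.

(** The algebra of one step of knot insertion: [u0] and [ul] are the outer
    knots, [w] and [v] the other end knots of the two new B-splines; [A], [B]
    are the old and [X], [Y], [Z] the new B-splines of lower degree. *)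
Lemma insert_algebra (u0 ul w v s x A B X Y Z : R) :
  (w - u0) * A = (s - u0) * X + (w - s) * Y ->
  (ul - v) * B = (s - v) * Y + (ul - s) * Z ->
  (w = u0 -> [/\ A = 0, X = 0 & Y = 0]) ->
  (ul = v -> [/\ B = 0, Y = 0 & Z = 0]) ->
  (x - u0) * A + (ul - x) * B =
  (s - u0) * (((x - u0) * X + (w - x) * Y) / (w - u0)) +
  (ul - s) * (((x - v) * Y + (ul - x) * Z) / (ul - v)).
Proof.
move=> E1 E2 D1 D2.
have F1 : w - u0 != 0 -> A = ((s - u0) * X + (w - s) * Y) / (w - u0).
  by move=> n; rewrite -E1 mulrAC mulfV // mul1r.
have F2 : ul - v != 0 -> B = ((s - v) * Y + (ul - s) * Z) / (ul - v).
  by move=> n; rewrite -E2 mulrAC mulfV // mul1r.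
have [e1|n1] := eqVneq w u0; have [e2|n2] := eqVneq ul v.
- have [-> -> ->] := D1 e1; have [-> _ ->] := D2 e2; ring.
- have [-> -> y0] := D1 e1; rewrite F2 ?subr_eq0 // y0.
  rewrite !(mulr0, addr0, add0r, mul0r); field.
  by rewrite subr_eq0.
- have [-> y0 ->] := D2 e2; rewrite F1 ?subr_eq0 // y0.
  rewrite !(mulr0, addr0, add0r, mul0r); field.
  by rewrite subr_eq0.
- by rewrite F1 ?subr_eq0 // F2 ?subr_eq0 //; field; rewrite !subr_eq0 n1 n2.
Qed.

(** Boehm's knot insertion. In this normalization no case distinction for
    degenerate knot intervals is needed. *)
Lemma nspline_insert tau k s q j x :
  (j < k <= j + q.+1)%N -> nondec tau j (j + q.+1)%N ->
  tau k.-1 <= s <= tau k ->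
  nspline tau q j x = (s - tau j) * mspline (insknot tau k s) q j x +
    (tau (j + q.+1)%N - s) * mspline (insknot tau k s) q j.+1 x.
Proof.
set tau' := insknot tau k s.
have Elt i : (i < k)%N -> tau' i = tau i by rewrite /tau' /insknot => ->.
have Egt i : (k < i)%N -> tau' i = tau i.-1.
  by rewrite /tau' /insknot => ki; rewrite ltnNge ltnW //= gtn_eqF.
have Ek : tau' k = s by rewrite /tau' /insknot ltnn eqxx.
elim: q j => [|q IH] j /andP[jk kj] nd /andP[s1 s2].
  have ek : k = j.+1 by nlia.
  rewrite ek /= in s1 s2 *; rewrite /nspline /= addn1.
  rewrite -ek Ek Elt ?ek // -ek Egt ?ek //=.
  have le1 : tau j <= tau j.+1 by apply: le_trans s2.
  have [h1|h1] := leP (tau j) x; have [h2|h2] := ltP x (tau j.+1);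
    have [h3|h3] := ltP x s; rewrite /= ?mulr0 ?addr0 ?add0r //.
  - by rewrite !mulfV // subr_eq0 gt_eqF // (le_lt_trans h1).
  - by rewrite !mulfV // subr_eq0 gt_eqF // ?(le_lt_trans h1) ?(le_lt_trans h3).
  - by have := lt_le_trans h3 (le_trans s2 h2); rewrite ltxx.
  - by have := le_lt_trans (le_trans s1 h3) h1; rewrite ltxx.
have nd1 : nondec tau j (j + q.+1)%N by apply: nondec_sub nd; nlia.
have nd2 : nondec tau j.+1 (j.+1 + q.+1)%N by apply: nondec_sub nd; nlia.
have nds l : (j <= l <= j + q.+2)%N -> (l < k)%N -> tau l <= s.
  by move=> lj lk; apply: le_trans s1; apply: nd; nlia.
have sdn l : (j <= l <= j + q.+2)%N -> (k <= l)%N -> s <= tau l.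
  by move=> lj lk; apply: le_trans s2 _; apply: nd; nlia.
have ndj : nondec tau' j (j + q.+3)%N.
  move=> a b ja ab bj; rewrite /tau' /insknot.
  case: (ltngtP a k) => ak; case: (ltngtP b k) => bk; try nlia; try by [].
  - by apply: nd; nlia.
  - by apply: nd; nlia.
  - by apply: nds; nlia.
  - by apply: nd; nlia.
  - by apply: sdn; nlia.
rewrite nsplineS //.
set A := mspline tau q j x; set B := mspline tau q j.+1 x.
set X := mspline tau' q j x; set Y := mspline tau' q j.+1 x.
set Z := mspline tau' q j.+2 x.
have [E1 D1] : (tau' (j + q.+2)%N - tau j) * A =
      (s - tau j) * X + (tau' (j + q.+2)%N - s) * Y /\
    (tau' (j + q.+2)%N = tau j -> [/\ A = 0, X = 0 & Y = 0]).
  have nd3 : nondec tau' j (j + q.+2)%N by apply: nondec_sub ndj; nlia.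
  have D' : tau' (j + q.+2)%N = tau j -> X = 0 /\ Y = 0.
    by rewrite -(Elt _ jk) => e; split; apply: (nondec_mspline_deg x nd3 (esym e)); nlia.
  case: (leqP k (j + q.+1)) => h; last first.
    have ek : (j + q.+2)%N = k by nlia.
    have AX : A = X by apply: eq_mspline => i iq; rewrite Elt //; nlia.
    split; last by move=> /D'[x0 y0]; rewrite AX.
    by rewrite ek Ek AX subrr mul0r addr0.
  have ew : tau' (j + q.+2)%N = tau (j + q.+1)%N by rewrite Egt ?addnS //; nlia.
  split; last first.
    move=> e; have [-> ->] := D' e; split=> //.
    by apply: mspline_deg; rewrite -ew.
  by rewrite ew; apply: IH; rewrite ?s1 ?s2 //; nlia.
have [E2 D2] : (tau (j + q.+2)%N - tau' j.+1) * B =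
      (s - tau' j.+1) * Y + (tau (j + q.+2)%N - s) * Z /\
    (tau (j + q.+2)%N = tau' j.+1 -> [/\ B = 0, Y = 0 & Z = 0]).
  have ez : tau' (j + q.+3)%N = tau (j + q.+2)%N by rewrite Egt ?addnS //; nlia.
  have nd3 : nondec tau' j.+1 (j + q.+3)%N by apply: nondec_sub ndj; nlia.
  have D' : tau (j + q.+2)%N = tau' j.+1 -> Y = 0 /\ Z = 0.
    by rewrite -ez => e; split; apply: (nondec_mspline_deg x nd3 (esym e)); nlia.
  case: (ltnP j.+1 k) => h; last first.
    have ek : j.+1 = k by nlia.
    have BZ : B = Z by apply: eq_mspline => i iq; rewrite Egt //; nlia.
    split; last by move=> /D'[y0 z0]; rewrite BZ.
    by rewrite ek Ek BZ subrr mul0r add0r.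
  have ew : tau' j.+1 = tau j.+1 by rewrite Elt.
  split; last first.
    move=> e; have [-> ->] := D' e; split=> //.
    by apply: mspline_deg; rewrite -ew addSnnS.
  rewrite ew -[in LHS]addSnnS -[in (_ - s)]addSnnS; apply: IH; rewrite ?s1 ?s2 //; nlia.
rewrite /= -/X -/Y -/Z Elt // addSnnS.
have -> : tau' (j + q.+3)%N = tau (j + q.+2)%N by rewrite Egt ?addnS //; nlia.
exact: insert_algebra.
Qed.

(** * Spline spaces *)

(** The linear combination with coefficients [c] of the B-splines of degree [p]
    whose knots are [p.+2] consecutive entries of the list [u]. *)
Definition splinel p u (c : nat -> R) x : R :=
  \sum_(j < size u - p.+1) c j * nspline (nth 0 u) p j x.

(** The span of these B-splines. *)
Definition splinespace p u (g : R -> R) : Prop := exists c, g =1 splinel p u c.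

Lemma splinespaceD p u g h : splinespace p u g -> splinespace p u h ->
  splinespace p u (fun x => g x + h x).
Proof.
move=> [c gc] [d hd]; exists (fun j => c j + d j) => x.
by rewrite gc hd -big_split; apply: eq_bigr => i _ /=; rewrite mulrDl.
Qed.

Lemma splinespaceZ p u k g : splinespace p u g ->
  splinespace p u (fun x => k * g x).
Proof.
move=> [c gc]; exists (fun j => k * c j) => x.
by rewrite gc big_distrr; apply: eq_bigr => i _ /=; rewrite mulrA.
Qed.

Lemma splinespace0 p u : splinespace p u (fun=> 0).
Proof. by exists (fun=> 0) => x; rewrite /splinel big1 // => i _; rewrite mul0r. Qed.

Lemma splinespace_sum p u n (F : nat -> R -> R) (c : nat -> R) :
  (forall j, (j < n)%N -> splinespace p u (F j)) ->
  splinespace p u (fun x => \sum_(j < n) c j * F j x).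
Proof.
elim: n => [|n IH] h.
  by case: (splinespace0 p u) => c0 E; exists c0 => x; rewrite big_ord0; exact: (E x).
have H1 : splinespace p u (fun x => \sum_(j < n) c j * F j x).
  by apply: IH => j jn; apply: h; nlia.
have [d E] := splinespaceD H1 (splinespaceZ (c n) (h n (leqnn _))).
by exists d => x; rewrite big_ord_recr; exact: (E x).
Qed.

Lemma splinespace_nspline p u j : (j < size u - p.+1)%N ->
  splinespace p u (nspline (nth 0 u) p j).
Proof.
move=> ju; exists (fun k => (k == j)%:R) => x.
rewrite /splinel (bigD1 (Ordinal ju)) //= eqxx mul1r big1 ?addr0 // => i ij.
by rewrite [_ == _](negbTE _) ?mul0r //; apply: contra ij => /eqP e; apply/eqP/val_inj.
Qed.

Lemma splinespace_mspline p u j : (j < size u - p.+1)%N ->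
  splinespace p u (mspline (nth 0 u) p j).
Proof.
move=> /splinespace_nspline /(splinespaceZ (u`_(j + p.+1) - u`_j)^-1) [c E].
exists c => x; rewrite -E /nspline mulrA.
have [e|n] := eqVneq (u`_(j + p.+1)) (u`_j); first by rewrite mspline_deg ?mulr0.
by rewrite mulVf ?mul1r // subr_eq0.
Qed.

(** The list [u] with [s] inserted at position [i]. *)
Definition inskl u i s := take i u ++ s :: drop i u.

Lemma nth_inskl u i s k : (i <= size u)%N ->
  (inskl u i s)`_k = insknot (nth 0 u) i s k.
Proof.
move=> iu; rewrite /inskl /insknot nth_cat size_takel //.
case: (ltngtP k i) => ki; first by rewrite nth_take.
- case: k ki => // k ki; rewrite subSn //= nth_drop; congr nth; lia.
- by rewrite ki subnn.
Qed.

Lemma size_inskl u i s : size (inskl u i s) = (size u).+1.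
Proof. by rewrite size_cat /= addnS -size_cat cat_take_drop. Qed.

Lemma sorted_nondec u lo hi : sorted <=%R u -> (hi < size u)%N ->
  nondec (nth 0 u) lo hi.
Proof.
move=> su hu k l _ kl lh.
apply: (sorted_leq_nth (@le_trans _ _) (@lexx _ _) 0 su); rewrite ?inE //.
  exact: leq_ltn_trans (leq_trans kl lh) hu.
exact: leq_ltn_trans lh hu.
Qed.

(** A B-spline for [u] either keeps its knots, possibly with shifted indices,
    or is split by [nspline_insert]. *)
Lemma splinespace_inskl p u i s g : (i <= size u)%N ->
  sorted <=%R (inskl u i s) -> splinespace p u g ->
  splinespace p (inskl u i s) g.
Proof.
move=> iu su' [c E]; set u' := inskl u i s.
have su : sorted <=%R u.
  rewrite -(cat_take_drop i u); apply: subseq_sorted su'; first exact: le_trans.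
  by rewrite /inskl; apply: cat_subseq; rewrite ?subseq_refl // subseq_cons.
have [d Ed] : splinespace p u' (fun x =>
    \sum_(j < size u - p.+1) c j * nspline (nth 0 u) p j x).
  apply: splinespace_sum => j ju.
  have N k : u'`_k = insknot (nth 0 u) i s k by exact: nth_inskl.
  have ju0 : (j < size u' - p.+1)%N by rewrite size_inskl; nlia.
  have ju1 : (j.+1 < size u' - p.+1)%N by rewrite size_inskl; nlia.
  case: (ltnP (j + p.+1) i) => [ji|ij].
    have [d Ed] := splinespace_nspline ju0; exists d => x.
    have W k : (k <= p.+1)%N -> u`_(j + k) = u'`_(j + k).
      by move=> kp; rewrite N /insknot ifT //; nlia.
    have W0 := W 0%N isT; rewrite addn0 in W0.
    by rewrite -Ed /nspline (eq_mspline x W) W // W0.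
  case: (leqP i j) => [ij'|ji].
    have [d Ed] := splinespace_nspline ju1; exists d => x.
    have W k : (k <= p.+1)%N -> u`_(j + k) = u'`_(j.+1 + k).
      by move=> kp; rewrite N /insknot ifF ?ifF ?addSn //; nlia.
    have W0 := W 0%N isT; rewrite !addn0 in W0.
    by rewrite -Ed /nspline (eq_mspline x W) W // W0.
  have [d Ed] := splinespaceD
    (splinespaceZ (s - u`_j) (splinespace_mspline ju0))
    (splinespaceZ (u`_(j + p.+1) - s) (splinespace_mspline ju1)).
  exists d => x; rewrite -Ed (@nspline_insert _ i s).
  - congr (_ * _ + _ * _); apply: eq_mspline => k kp; exact/esym/N.
  - by rewrite ji ij.
  - by apply: sorted_nondec => //; nlia.
  - have nd : nondec (nth 0 u') i.-1 i.+1.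
      by apply: sorted_nondec => //; rewrite size_inskl; nlia.
    have n0 : u'`_i.-1 = u`_i.-1 by rewrite N /insknot ifT //; nlia.
    have n1 : u'`_i = s by rewrite N /insknot ltnn eqxx.
    have n2 : u'`_i.+1 = u`_i by rewrite N /insknot ifF ?ifF //; nlia.
    by rewrite -n0 -n2 -n1 !nd //; nlia.
by exists d => x; rewrite E -Ed.
Qed.

(** A proper subsequence can be enlarged by one element. *)
Lemma subseq_inskl (u v : seq R) : subseq u v ->
  u = v \/ exists i s, (i <= size u)%N /\ subseq (inskl u i s) v.
Proof.
elim: v u => [|y v IH] [|x u] //=; first by left.
  by move=> _; right; exists 0%N, y; rewrite /inskl /= eqxx sub0seq.
case: eqP => [->|ne] h.
  have [->|[i [s [iu h']]]] := IH _ h; first by left.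
  by right; exists i.+1, s; split=> //; rewrite /inskl /= eqxx.
by right; exists 0%N, y; split=> //; rewrite /inskl /= eqxx.
Qed.

(** Refining the knots enlarges the spline space. *)
Lemma splinespace_subseq p u v g : sorted <=%R v -> subseq u v ->
  splinespace p u g -> splinespace p v g.
Proof.
move=> sv; have [n] := ubnP (size v - size u); elim: n u => // n IH u h uv ug.
have [<- //|[i [s [iu sub]]]] := subseq_inskl uv.
apply: (IH (inskl u i s)) => //.
  by have : (size (inskl u i s) <= size v)%N := size_subseq sub; rewrite size_inskl; nlia.
by apply: splinespace_inskl => //; apply: subseq_sorted sv => //; exact: le_trans.
Qed.

End msplines.

Section mesh_splines.
Context {R : realType} (G : curve R) (p : nat).
Implicit Types T : mesh R.

Lemma pknots_cons (zm : R * nat) T :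
  pknots (zm :: T) = nseq zm.2 zm.1 ++ pknots T.
Proof. by []. Qed.

Lemma pknots_sorted T : sorted <%R (unzip1 T) -> sorted <=%R (pknots T).
Proof.
rewrite (sorted_pairwise lt_trans) (sorted_pairwise le_trans).
elim: T => [|[z m] T IH] //= /andP[zT sT].
rewrite pairwise_cat IH // andbT; apply/andP; split; last first.
  by elim: m => //= m ->; rewrite andbT; apply/allP => x /nseqP[-> _].
apply/allrelP => x y /nseqP[-> _] /flattenP[s /mapP[[z' m'] zT' ->]] /nseqP[-> _] /=.
by apply/ltW/(allP zT)/mapP; exists (z', m').
Qed.

Lemma tknot_nth T j : (j < size (pknots T))%N ->
  tknot G p T (j%:Z - p%:Z) = (pknots T)`_j.
Proof. by move=> h; rewrite /tknot subrK h. Qed.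

Lemma spline_splinel T (c : int -> R) x : sorted <%R (unzip1 T) ->
  spline G p T c x =
  splinel p (pknots T) (fun j => c (1 - p%:Z + j%:Z)) x.
Proof.
move=> sT; apply: eq_bigr => j _; congr (_ * _).
have js : (j < size (pknots T) - p.+1)%N := ltn_ord j.
have js' k : (k <= p.+1)%N -> (j + k < size (pknots T))%N by move=> kp; nlia.
apply: bspline_nspline.
  exact: (sorted_nondec (pknots_sorted sT) (js' _ (leqnn _))).
move=> k kp; rewrite -tknot_nth; last exact: js'.
congr (tknot _ _ _ _); rewrite PoszD; ring.
Qed.

Lemma splineP T g : sorted <%R (unzip1 T) ->
  (exists c, g =1 spline G p T c) <-> splinespace p (pknots T) g.
Proof.
move=> sT; split=> [[c E]|[c E]].
  by exists (fun j => c (1 - p%:Z + j%:Z)) => x; rewrite E spline_splinel.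
exists (fun i : int => c (absz (i + p%:Z - 1)%R)) => x.
rewrite spline_splinel // E; apply: eq_bigr => j _; congr (c _ * _).
lia.
Qed.

Lemma ansatz_subseq T0 W0 T T' : sorted <%R (unzip1 T) -> sorted <%R (unzip1 T') ->
  subseq (pknots T) (pknots T') ->
  ansatz G p T0 W0 T `<=` ansatz G p T0 W0 T'.
Proof.
move=> sT sT' sub Psi [c E].
have [|d Ed] := (splineP (spline G p T c) sT').2.
  apply: splinespace_subseq sub _; first exact: pknots_sorted.
  by apply/splineP => //; exists c.
by exists d => t tab; rewrite E // Ed.
Qed.

Local Notation a := (ca G).
Local Notation b := (cb G).

Lemma mesh_ends T : is_mesh G p T ->
  exists s, T = (a, p.+1) :: rcons s (b, p.+1).
Proof.
case: T => [[]//|[z m] T] [n0 _ [z0 zn] _ [m0 mn]].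
case/lastP: T n0 z0 zn m0 mn => [//|s [z' m']] _ /= z0 zn m0 mn; exists s.
move: z0 zn m0 mn; rewrite /zpar /mult /ncells /unzip1 /unzip2 /=.
rewrite size_rcons !map_rcons /=.
rewrite !nth_rcons !size_map ltnn eqxx /= => z0 zn m0 mn.
by rewrite z0 zn m0 mn.
Qed.

Lemma mesh_sorted T : is_mesh G p T -> sorted <%R (unzip1 T).
Proof. by case=> _ []. Qed.

Lemma pknots_ends T : is_mesh G p T ->
  [/\ size (pknots T) = (Ndim p T + p.+1)%N,
      (forall i, (i <= p)%N -> (pknots T)`_i = a) &
      (forall i, (Ndim p T <= i <= Ndim p T + p)%N -> (pknots T)`_i = b)].
Proof.
move=> /mesh_ends[s ->].
have E : pknots ((a, p.+1) :: rcons s (b, p.+1)) =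
    nseq p.+1 a ++ pknots s ++ nseq p.+1 b.
  by rewrite pknots_cons /pknots map_rcons flatten_rcons.
set m := size (pknots s).
have sz : size (pknots ((a, p.+1) :: rcons s (b, p.+1))) = (m + p.+1 + p.+1)%N.
  by rewrite E !size_cat !size_nseq addnA (addnC p.+1).
have nE : Ndim p ((a, p.+1) :: rcons s (b, p.+1)) = (m + p.+1)%N.
  by rewrite /Ndim sz addnK.
rewrite sz nE E; split => //.
  by move=> i ip; rewrite nth_cat size_nseq ltnS ip nth_nseq ltnS ip.
move=> i ip; rewrite nth_cat size_nseq ifF; last by nlia.
rewrite nth_cat ifF -/m; last by nlia.
by rewrite nth_nseq ifT //; nlia.
Qed.

Lemma sum_mesh_nspline T x : is_mesh G p T -> x \in `[a, b[ ->
  \sum_(j < Ndim p T) nspline (nth 0 (pknots T)) p j x = 1.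
Proof.
move=> mT; rewrite in_itv /= => xab.
have [sz ea eb] := pknots_ends mT.
have n0 : (Ndim p T <= Ndim p T <= Ndim p T + p)%N by nlia.
have n1 : (Ndim p T <= Ndim p T + p <= Ndim p T + p)%N by nlia.
apply: sum_nspline; rewrite ?(ea 0%N) ?(ea p) ?(eb _ n0) ?(eb _ n1) //.
by apply: (sorted_nondec (pknots_sorted (mesh_sorted mT))); rewrite sz; nlia.
Qed.

Lemma mesh_nspline_ge0 T j x : is_mesh G p T -> (j < Ndim p T)%N ->
  0 <= nspline (nth 0 (pknots T)) p j x.
Proof.
move=> mT jn; have [sz _ _] := pknots_ends mT.
apply: nspline_ge0.
by apply: (sorted_nondec (pknots_sorted (mesh_sorted mT))); rewrite sz; nlia.
Qed.

Lemma spline_bounded T (c : int -> R) : is_mesh G p T ->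
  exists C, forall x, x \in `[a, b[ -> `|spline G p T c x| <= C.
Proof.
move=> mT; set c' := fun j : nat => c (1 - p%:Z + j%:Z).
exists (\sum_(j < Ndim p T) `|c' j|) => x xab.
rewrite spline_splinel ?mesh_sorted //.
apply: le_trans (ler_norm_sum _ _ _) _; apply: ler_sum => j _.
have g0 := mesh_nspline_ge0 x mT (ltn_ord j).
rewrite normrM ler_piMr // ger0_norm // -(sum_mesh_nspline mT xab).
rewrite (bigD1 j) //= lerDl sumr_ge0 // => i _.
exact: mesh_nspline_ge0.
Qed.

(** Positive weights have a positive minimum, which bounds the weight function
    from below by the partition of unity. *)
Lemma spline_weights T W0 : is_mesh G p T -> positive_weights p T W0 ->
  exists2 e, 0 < e & forall x, x \in `[a, b[ -> e <= spline G p T W0 x.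
Proof.
move=> mT pW; set c' := fun j : nat => W0 (1 - p%:Z + j%:Z).
have cp j : (j < Ndim p T)%N -> 0 < c' j by move=> jn; apply: pW; lia.
have [e e0 ec] : exists2 e : R, 0 < e & forall j, (j < Ndim p T)%N -> e <= c' j.
  elim: (Ndim p T) cp => [|n IH] cp; first by exists 1.
  have [|e e0 ec] := IH; first by move=> j jn; apply: cp; nlia.
  exists (Num.min e (c' n)); first by rewrite lt_min e0 cp.
  move=> j; rewrite ltnS leq_eqVlt => /orP[/eqP ->|jn].
    by rewrite ge_min lexx orbT.
  by rewrite ge_min ec.
exists e => // x xab; rewrite spline_splinel ?mesh_sorted //.
rewrite -[e]mulr1 -(sum_mesh_nspline mT xab) big_distrr /=.
apply: ler_sum => j _; rewrite ler_wpM2r ?ec //.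
exact: mesh_nspline_ge0.
Qed.

Lemma measurable_mspline tau q j : measurable_fun setT (@mspline R tau q j).
Proof.
elim: q j => [|q IH] j.
  rewrite [X in measurable_fun _ X](_ : _ = fun x =>
      (tau j.+1 - tau j)^-1 * \1_(`[tau j, tau j.+1[%classic) x); last first.
    apply/funext => x; rewrite indicE mem_setE /= in_itv /=.
    by case: ifP; rewrite ?mulr1 ?mulr0.
  by apply: measurable_funM => //; apply: measurable_indic.
apply: measurable_funM => //; apply: measurable_funD.
  by apply: measurable_funM => //; apply: measurable_funB.
by apply: measurable_funM => //; apply: measurable_funB.
Qed.

Lemma measurable_spline T c : is_mesh G p T -> measurable_fun setT (spline G p T c).
Proof.
move=> mT; rewrite [X in measurable_fun _ X](_ : _ = fun x =>
    \sum_(j < Ndim p T) c (1 - p%:Z + j%:Z) *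
      nspline (nth 0 (pknots T)) p j x); last first.
  by apply/funext => x; rewrite spline_splinel // mesh_sorted.
apply: measurable_sum => j; apply: measurable_funM => //.
by apply: measurable_funM => //; exact: measurable_mspline.
Qed.

(** The weight function is bounded away from [0] on [a, b), so that the
    functions of the ansatz space are bounded. *)
Lemma ansatz_bounded T0 W0 T Psi : is_mesh G p T0 -> positive_weights p T0 W0 ->
  is_mesh G p T -> ansatz G p T0 W0 T Psi ->
  measurable_fun `[a, b] (Psi \o G) /\
  exists C, forall t, t \in `[a, b] -> `|Psi (G t)| <= C.
Proof.
move=> mT0 pW mT [c E].
have [C hC] := spline_bounded c mT; have [e e0 he] := spline_weights mT0 pW.
split.
  have ab : a <= b.
    have [s es] := mesh_ends mT; have := mesh_sorted mT; rewrite es.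
    rewrite (sorted_pairwise lt_trans) /unzip1 /= map_rcons all_rcons /=.
    by move=> /andP[/andP[/ltW]].
  rewrite -(@setUitv1 _ _ (BLeft a) b true) ?bnd_simp //.
  apply/measurable_funU => //; split; last first.
    exact: measurable_fun_set1.
  apply: (@eq_measurable_fun _ _ _ _ _
    (fun t => spline G p T c t * (spline G p T0 W0 t)^-1)).
    by move=> t; rewrite inE => tab; rewrite /= E.
  apply: measurable_funM; first by apply: measurable_funTS; exact: measurable_spline.
  apply: measurable_funTS; apply: measurableT_comp; last exact: measurable_spline.
  exact: measurable_invr.
exists (Num.max (C / e) `|Psi (G b)|) => t; rewrite in_itv /= => /andP[ta].
rewrite le_eqVlt => /predU1P[->|tb]; first by rewrite le_max lexx orbT.
have tab : t \in `[a, b[ by rewrite in_itv /= ta.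
rewrite E // le_max; apply/orP; left.
have w := he _ tab; have w0 := lt_le_trans e0 w.
rewrite normrM normfV (gtr0_norm w0) ler_pM ?invr_ge0 ?(ltW w0) ?hC //.
by rewrite lef_pV2.
Qed.

End mesh_splines.

(** * The parametrization and its speed *)
Section speed.
Context {R : realType} (G : curve R).
Local Notation a := (ca G).
Local Notation b := (cb G).

Lemma cext_itv t : a < b -> t \in `[a, b[ -> cext G t = G t.
Proof.
rewrite in_itv /= /cext => ab /andP[at_ tb]; case: ifP => // _.
rewrite (@floor_def _ _ 0) ?mul0r ?subr0 // add0r /=.
by rewrite divr_ge0 ?subr_ge0 ?(ltW ab) //= ltr_pdivrMr ?subr_gt0 // mul1r ltrD2r.
Qed.

(** The right difference quotient at [t] only sees the interval from [t] to [d],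
    where [g] agrees with the differentiable function [k]. *)
Lemma rquot_lim (g k : R -> R) (c d t : R) : derivable k t 1 ->
  (forall s, c <= s < d -> g s = k s) -> c <= t < d ->
  lim ((fun h => (g (t + h) - g t) / h) @ (0 : R)^'+) = derive1 k t.
Proof.
move=> dk gk /andP[ct td].
have K : h^-1 *: (k (h + t) - k t) @[h --> (0:R)^'] --> derive1 k t.
  rewrite /derive1; move: dk; rewrite /derivable => dk.
  suff -> : (fun h : R => h^-1 *: (k (h + t) - k t)) =
      (fun h : R => h^-1 *: ((k \o shift t) (h *: (1 : R^o)) - k t)) by exact: dk.
  by apply/funext => h /=; rewrite /shift /= /GRing.scale /= mulr1.
have K' : h^-1 *: (k (h + t) - k t) @[h --> (0:R)^'+] --> derive1 k t.
  exact: (cvg_dnbhs_at_right K).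
apply: (cvg_lim (@Rhausdorff R)); apply: cvg_trans K'; apply: near_eq_cvg.
near=> h.
rewrite (gk t) ?ct // gk; first by rewrite /GRing.scale /= mulrC (addrC h).
have h0 : 0 < h by near: h; exact: nbhs_right_gt.
rewrite (le_trans ct) /= ?lerDl ?(ltW h0) // -ltrBrDl.
near: h; apply: nbhs_right_lt; rewrite subr_gt0 //.
Unshelve. all: by end_near. Qed.

Lemma speed_eq (c d : R) (k1 k2 : R -> R) t : a < b -> a <= c -> d <= b ->
  derivable k1 t 1 -> derivable k2 t 1 ->
  {in `[c, d], k1 =1 (fun t => (G t).1)} -> {in `[c, d], k2 =1 (fun t => (G t).2)} ->
  t \in `[c, d[ ->
  speed G t = Num.sqrt (derive1 k1 t ^+ 2 + derive1 k2 t ^+ 2).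
Proof.
move=> ab ac db d1 d2 E1 E2; rewrite in_itv /= => tcd.
have E s : c <= s < d -> (cext G s).1 = k1 s /\ (cext G s).2 = k2 s.
  move=> /andP[cs sd]; rewrite cext_itv //; last first.
    by rewrite in_itv /= (le_trans ac) // (lt_le_trans sd).
  by split; [rewrite E1 | rewrite E2]; rewrite // in_itv /= cs ltW.
rewrite /speed /enorm /rder /=.
rewrite (@rquot_lim (fun s => (cext G s).1) k1 c d) //; last by move=> s /E[].
by rewrite (@rquot_lim (fun s => (cext G s).2) k2 c d) //; last by move=> s /E[].
Qed.

Lemma speed_ge0 t : 0 <= speed G t. Proof. exact: sqrtr_ge0. Qed.

Lemma speed_piece (c d : R) : a < b -> a <= c -> c <= d -> d <= b ->
  C2_on (fun t => (G t).1) c d -> C2_on (fun t => (G t).2) c d ->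
  measurable_fun `[c, d[ (speed G) /\
  exists C, forall t, t \in `[c, d[ -> speed G t <= C.
Proof.
move=> ab ac cd db [k1 [d1 dd1 _] E1] [k2 [d2 dd2 _] E2].
pose q t := Num.sqrt (derive1 k1 t ^+ 2 + derive1 k2 t ^+ 2).
have E t : t \in `[c, d[ -> speed G t = q t.
  by move=> tcd; exact: (speed_eq ab ac db (d1 t) (d2 t) E1 E2).
have cq : continuous q.
  move=> t; apply: continuous_comp; last exact: sqrt_continuous.
  have c1 : {for t, continuous (derive1 k1)}.
    by apply/differentiable_continuous/derivable1_diffP/dd1.
  have c2 : {for t, continuous (derive1 k2)}.
    by apply/differentiable_continuous/derivable1_diffP/dd2.
  by apply: cvgD; apply: cvgM.
split.
  apply: (@eq_measurable_fun _ _ _ _ _ q); first by move=> t; rewrite inE => /E.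
  by apply: measurable_funTS; exact: continuous_measurable_fun.
have [|x _ hx] := @EVT_max R q c d cd.
  exact: continuous_subspaceT.
exists (q x) => t tcd; rewrite E //; apply: hx.
by move: tcd; rewrite !in_itv /= => /andP[-> /ltW].
Qed.

Lemma speed_path (c : R) s : a < b -> a <= c -> path <%R c s -> last c s = b ->
  C2_between G (c :: s) ->
  measurable_fun `[c, b] (speed G) /\
  exists C, forall t, t \in `[c, b] -> speed G t <= C.
Proof.
elim: s c => [|d s IH] c ab ac /=.
  move=> _ -> _; rewrite set_itv1; split; first exact: measurable_fun_set1.
  exists (speed G b) => t; rewrite in_itv /= => /andP[h1 h2].
  by rewrite (@le_anti _ _ t b) ?h1 ?h2.
move=> /andP[cd pd] lb C2.
have db : d <= b by rewrite -lb; have := mem_last d s; rewrite inE => /predU1P[->//|];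
  move: pd; rewrite (path_sortedE lt_trans) => /andP[/allP h _] /h /ltW.
have [C21 C22] := C2 0%N isT.
have [mI [C1 B1]] := speed_piece ab ac (ltW cd) db C21 C22.
have [|mII [C2' B2]] := IH d ab (le_trans ac (ltW cd)) pd lb.
  by move=> i; exact: (C2 i.+1).
split.
  rewrite (@itv_bndbnd_setU _ _ (BLeft c) (BLeft d) (BRight b)) ?bnd_simp ?(ltW cd) //.
  by apply/measurable_funU => //.
exists (Num.max C1 C2') => t; rewrite in_itv /= => /andP[ct tb].
rewrite le_max; case: (ltP t d) => td; first by rewrite B1 // in_itv /= ct.
by rewrite B2 ?orbT // in_itv /= td.
Qed.

Lemma bd_speed Omega : boundary_curve G Omega ->
  measurable_fun `[a, b] (speed G) /\
  exists C, forall t, t \in `[a, b] -> speed G t <= C.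
Proof. by case=> ab _ [s [ps ls C2]] _ _; exact: (@speed_path a s). Qed.

Lemma measurable_curve : {within `[a, b], continuous G} ->
  measurable_fun `[a, b] (fun t => (G t).1) /\
  measurable_fun `[a, b] (fun t => (G t).2).
Proof.
move=> cG; split; apply: subspace_continuous_measurable_fun => // t;
  (apply: continuous_comp; first exact: cG).
  exact: cvg_fst.
exact: cvg_snd.
Qed.

(** The parametrization is uniformly continuous. *)
Lemma curve_unif : {within `[a, b], continuous G} -> forall e : R, 0 < e ->
  exists2 d : R, 0 < d & forall s t, s \in `[a, b] -> t \in `[a, b] ->
    `|s - t| <= d -> Defs.edist (G s) (G t) <= e.
Proof.
move=> cG e e0; have e40 : 0 < e / 4 by rewrite divr_gt0.
have cov : near_covering_within `[a, b].
  by apply/near_covering_withinP/compact_near_coveringP; exact: segment_compact.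
pose P (d x : R) := forall t, t \in `[a, b] -> `|x - t| <= d ->
  Defs.edist (G x) (G t) <= e.
have near_x x : `[a, b]%classic x -> \forall x' \near x & d \near (0:R)^'+,
    `[a, b]%classic x' -> P d x'.
  move=> xab; have /subspace_continuousP/(_ x xab)/cvgrPdist_lt/(_ _ e40) := cG.
  rewrite near_withinE => /nbhs_ballP[r /= r0 hr].
  have hr' s : `|x - s| < r -> s \in `[a, b] -> `|G x - G s| < e / 4.
    by move=> xs sab; apply: hr.
  have r20 : 0 < r / 2 by rewrite divr_gt0.
  have N : \forall z \near x, `|x - z| < r / 2 by apply/nbhs_ballP; exists (r / 2).
  near=> x' d => x'ab t tab xt.
  have xx' : `|x - x'| < r / 2 by near: x'; exact: N.
  have dr : d < r / 2 by near: d; exact: nbhs_right_lt.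
  have h1 : `|G x - G x'| < e / 4.
    by apply: hr' => //; rewrite (lt_le_trans xx') // ler_pdivrMr // ler_peMr // ler1n.
  have h2 : `|G x - G t| < e / 4.
    apply: hr' => //; rewrite -(subrKA x'); apply: le_lt_trans (ler_normD _ _) _.
    by rewrite [r]splitr ltrD // (le_lt_trans xt).
  have h3 : `|G x' - G t| <= e / 2.
    rewrite -(subrKA (G x)); apply: le_trans (ler_normD _ _) _.
    by rewrite distrC; lra.
  rewrite prod_normE ge_max /= in h3; case/andP: h3 => h31 h32.
  rewrite /Defs.edist /enorm /= -(ler_pXn2r (n := 2)) ?nnegrE ?sqrtr_ge0 ?(ltW e0) //.
  rewrite sqr_sqrtr ?addr_ge0 ?sqr_ge0 //.
  rewrite -[(_ - _) ^+ 2]real_normK ?num_real // -[X in _ + X]real_normK ?num_real //.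
  move: h31 h32 (normr_ge0 ((G x').1 - (G t).1)) (normr_ge0 ((G x').2 - (G t).2)).
  move: `|_| `|(G x').2 - _| => u v ue ve u0 v0.
  nra.
have /nbhs_ballP[d /= d0 hd] := cov _ _ _ (at_right_proper_filter _) near_x.
have m0 : 0 < d / 2 by rewrite divr_gt0.
exists (d / 2) => // s t sab tab st; apply: (hd (d / 2)) => //.
rewrite /ball /= sub0r normrN gtr0_norm // ltr_pdivrMr // ltr_pMr // ltr1n //.
Unshelve. all: by end_near. Qed.

End speed.

(** * The Slobodeckij seminorm as an integral over the plane *)
Section kernel.
Context {R : realType} {G : curve R} {Omega : set (R * R)}.
Context (hG : boundary_curve G Omega).
Local Notation a := (ca G).
Local Notation b := (cb G).
Local Notation mu := (@lebesgue_measure R).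
Local Notation J := (`[a, b]%classic : set R).
Implicit Types u v : R * R -> R.

Let mspeed : measurable_fun J (speed G). Proof. by case: (bd_speed hG). Qed.
Let cG : {within `[a, b], continuous G}. Proof. by case: hG. Qed.
Let mI : measurable J. Proof. exact: measurable_itv. Qed.

(** The squared distance of the points with parameters [z.1] and [z.2]; the
    coordinates are extended by [0] outside of the parameter interval to obtain
    a measurable function on the plane. *)
Definition sqdist (z : R * R) : R :=
  (((fun t => (G t).1) \_ J) z.1 - ((fun t => (G t).1) \_ J) z.2) ^+ 2 +
  (((fun t => (G t).2) \_ J) z.1 - ((fun t => (G t).2) \_ J) z.2) ^+ 2.

(** The integrand of the double integral defining the seminorm, including the
    length elements, extended by [0] outside of the parameter square. *)
Definition kern u (z : R * R) : R :=
  (((u \o G) \_ J) z.1 - ((u \o G) \_ J) z.2) ^+ 2 / sqdist z *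
  (speed G \_ J) z.2 * (speed G \_ J) z.1.

Lemma patchI (f : R -> R) t : t \in `[a, b] -> (f \_ J) t = f t.
Proof. by move=> tI; rewrite patchE mem_set. Qed.

Lemma sqdistE s t : s \in `[a, b] -> t \in `[a, b] ->
  sqdist (s, t) = Defs.edist (G s) (G t) ^+ 2.
Proof.
move=> sI tI; rewrite /sqdist /= !patchI //.
by rewrite /Defs.edist /enorm sqr_sqrtr ?addr_ge0 ?sqr_ge0.
Qed.

Lemma kernE u s t : s \in `[a, b] -> t \in `[a, b] ->
  kern u (s, t) = (u (G s) - u (G t)) ^+ 2 / Defs.edist (G s) (G t) ^+ 2 *
    speed G t * speed G s.
Proof. by move=> sI tI; rewrite /kern /= !patchI // sqdistE. Qed.

Lemma sp_ge0 t : 0 <= (speed G \_ J) t.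
Proof. by rewrite patchE; case: ifP => // _; exact: speed_ge0. Qed.

Lemma sqdist_ge0 z : 0 <= sqdist z.
Proof. by rewrite addr_ge0 ?sqr_ge0. Qed.

Lemma kern_ge0 u z : 0 <= kern u z.
Proof.
by apply: mulr_ge0; rewrite ?sp_ge0 // mulr_ge0 ?sp_ge0 // divr_ge0 ?sqr_ge0 ?sqdist_ge0.
Qed.

Lemma measurable_fst1 (f : R -> R) : measurable_fun J f ->
  measurable_fun [set: R * R] (fun z => (f \_ J) z.1).
Proof.
move=> mf; apply: measurableT_comp; last exact: measurable_fst.
exact: (measurable_restrictT f mI).1.
Qed.

Lemma measurable_snd1 (f : R -> R) : measurable_fun J f ->
  measurable_fun [set: R * R] (fun z => (f \_ J) z.2).
Proof.
move=> mf; apply: measurableT_comp; last exact: measurable_snd.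
exact: (measurable_restrictT f mI).1.
Qed.

Lemma measurable_sqdist : measurable_fun [set: R * R] sqdist.
Proof.
have [m1 m2] := measurable_curve cG.
apply: measurable_funD; apply: measurable_funX; apply: measurable_funB;
  by [apply: measurable_fst1 | apply: measurable_snd1].
Qed.

Lemma measurable_kern u : measurable_fun J (u \o G) ->
  measurable_fun [set: R * R] (kern u).
Proof.
move=> mu'; apply: measurable_funM; last exact: measurable_fst1.
apply: measurable_funM; last exact: measurable_snd1.
apply: measurable_funM.
  by apply: measurable_funX; apply: measurable_funB;
    [apply: measurable_fst1 | apply: measurable_snd1].
apply: measurableT_comp; [exact: measurable_invr | exact: measurable_sqdist].
Qed.

Local Notation nu := (mu \x mu)%E.

(** The integral of the kernel over the square with side [A]. *)
Definition kint u (A : set R) : \bar R :=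
  (\int[nu]_z (\1_A z.1 * \1_A z.2 * kern u z)%:E)%E.

Lemma measurable_kint u A : measurable_fun J (u \o G) -> measurable A ->
  measurable_fun [set: R * R] (fun z : R * R => (\1_A z.1 * \1_A z.2 * kern u z)).
Proof.
move=> mu' mA; apply: measurable_funM; last exact: measurable_kern.
by apply: measurable_funM; apply: measurableT_comp.
Qed.

Lemma kint_ge0 u (A : set R) (z : R * R) :
  0 <= \1_A z.1 * \1_A z.2 * kern u z.
Proof. by apply: mulr_ge0; rewrite ?kern_ge0 // mulr_ge0 // indicE. Qed.

Lemma semisq_kint u E : measurable_fun J (u \o G) -> measurable (J `&` G @^-1` E) ->
  semisq G E u = kint u (J `&` G @^-1` E).
Proof.
rewrite /kint; set A := J `&` G @^-1` E => mu' mA.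
have AI t : A t -> t \in `[a, b] by case.
have mk := measurable_kint mu' mA.
rewrite fubini_tonelli1; last 2 first.
- exact/measurable_EFinP.
- by move=> z; rewrite lee_fin kint_ge0.
rewrite /semisq /arcint -/A integral_mkcond; apply: eq_integral => s _.
rewrite /fubini_F patchE; case: ifPn => sA; last first.
  rewrite integral0_eq // => t _; rewrite /= indicE.
  by rewrite (negbTE sA) !mul0r.
have sI : s \in `[a, b] by move: sA; rewrite inE => /AI.
have EK : {in A, (fun t => ((u (G s) - u (G t)) ^+ 2 /
      Defs.edist (G s) (G t) ^+ 2 * speed G t) * speed G s) =1
    (fun t => kern u (s, t))}.
  by move=> t; rewrite inE => /AI tI; rewrite kernE.
have Eq t : A t -> (u (G s) - u (G t)) ^+ 2 /
      Defs.edist (G s) (G t) ^+ 2 * speed G t =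
    (((u \o G) \_ J) s - ((u \o G) \_ J) t) ^+ 2 / sqdist (s, t) * (speed G \_ J) t.
  by move=> /AI tI; rewrite sqdistE // !patchI.
rewrite -ge0_integralZr //; last 3 first.
- apply/measurable_EFinP; apply: (@eq_measurable_fun _ _ _ _ _
    (fun t => (((u \o G) \_ J) s - ((u \o G) \_ J) t) ^+ 2 / sqdist (s, t) *
       (speed G \_ J) t)).
    by move=> t; rewrite inE => At; rewrite Eq.
  apply: measurable_funTS; apply: measurable_funM; last exact: (measurable_restrictT _ mI).1.
  apply: measurable_funM; first apply: measurable_funX.
    by apply: measurable_funB => //; exact: (measurable_restrictT _ mI).1.
  apply: measurableT_comp; first exact: measurable_invr.
  exact: (measurable_fun_pair2 s measurable_sqdist).
- move=> t At; rewrite -EFinM lee_fin mulr_ge0 ?speed_ge0 //.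
  by rewrite divr_ge0 ?sqr_ge0.
- by rewrite lee_fin speed_ge0.
rewrite integral_mkcond; apply: eq_integral => t _.
rewrite patchE; case: ifPn => tA; last first.
  by rewrite indicE /= indicE (negbTE tA) mulr0 mul0r.
by rewrite /= !indicE sA tA !mul1r -!EFinM -EK.
Qed.

Lemma kint_le u v A c d : measurable A ->
  measurable_fun J (u \o G) -> measurable_fun J (v \o G) -> 0 <= c -> 0 <= d ->
  forall w, measurable_fun J (w \o G) ->
  (forall z, kern w z <= c * kern u z + d * kern v z) ->
  (kint w A <= c%:E * kint u A + d%:E * kint v A)%E.
Proof.
move=> mA mu' mv c0 d0 w mw h; rewrite /kint.
have mk x : measurable_fun J (x \o G) -> measurable_fun [set: R * R]
    (fun z : R * R => (\1_A z.1 * \1_A z.2 * kern x z)%:E).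
  by move=> mx; apply/measurable_EFinP; exact: measurable_kint.
have k0 x z : (0 <= (\1_A z.1 * \1_A z.2 * kern x z)%:E)%E.
  by rewrite lee_fin kint_ge0.
rewrite -ge0_integralZl //; [|exact: mk].
rewrite -ge0_integralZl //; [|exact: mk].
rewrite -ge0_integralD //; last 4 first.
- by move=> z _; rewrite mule_ge0.
- by apply: measurable_funeM; exact: mk.
- by move=> z _; rewrite mule_ge0.
- by apply: measurable_funeM; exact: mk.
apply: ge0_le_integral => //; [exact: mk| |].
  by apply: emeasurable_funD; apply: measurable_funeM; exact: mk.
move=> z _; rewrite -!EFinM -EFinD lee_fin.
by rewrite !(mulrCA _ (\1_A z.1 * \1_A z.2)) -mulrDr ler_wpM2l.
Qed.

Lemma kern_comb c u v z :
  kern (fun x => c * u x + v x) z <= (2 * c ^+ 2) * kern u z + 2 * kern v z.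
Proof.
have E w : kern w z = (((w \o G) \_ J) z.1 - ((w \o G) \_ J) z.2) ^+ 2 *
    ((sqdist z)^-1 * (speed G \_ J) z.2 * (speed G \_ J) z.1).
  by rewrite /kern !mulrA.
rewrite !E !mulrA -!mulrDl; do 3 rewrite ler_wpM2r ?sp_ge0 ?invr_ge0 ?sqdist_ge0 //.
have P t : (((fun x => c * u x + v x) \o G) \_ J) t =
    c * ((u \o G) \_ J) t + ((v \o G) \_ J) t.
  by rewrite !patchE; case: ifP => //= _; rewrite /point /= mulr0 addr0.
rewrite !P; move: (((u \o G) \_ J) z.1) (((u \o G) \_ J) z.2)
  (((v \o G) \_ J) z.1) (((v \o G) \_ J) z.2) => x1 x2 y1 y2.
have := sqr_ge0 (c * (x1 - x2) - (y1 - y2)); nra.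
Qed.

Lemma measurable_comb c u v : measurable_fun J (u \o G) ->
  measurable_fun J (v \o G) -> measurable_fun J ((fun x => c * u x + v x) \o G).
Proof. by move=> mu' mv; apply: measurable_funD => //; apply: measurable_funM. Qed.

Lemma kint_comb c u v A : measurable A ->
  measurable_fun J (u \o G) -> measurable_fun J (v \o G) ->
  (kint (fun x => c * u x + v x)%R A <=
   (2 * c ^+ 2)%:E * kint u A + 2%:E * kint v A)%E.
Proof.
move=> mA mu' mv; apply: kint_le => //; first by rewrite mulr_ge0 // sqr_ge0.
- exact: measurable_comb.
- exact: kern_comb.
Qed.

Lemma kern_supp u z : \1_J z.1 * \1_J z.2 * kern u z = kern u z.
Proof.
rewrite /kern !indicE !patchE; case: (z.1 \in J); case: (z.2 \in J);
  by rewrite ?mul1r ?mulr1 ?mul0r ?mulr0 //= /point /= ?mulr0 ?mul0r.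
Qed.

(** The part of the seminorm stemming from pairs of points with squared
    distance at most [d]. *)
Definition nint u (d : R) : \bar R :=
  (\int[nu]_z (\1_[set z | sqdist z <= d] z * kern u z)%:E)%E.

Lemma measurable_near d : measurable [set z | sqdist z <= d].
Proof.
have := measurable_fun_ler measurable_sqdist (measurable_cst d).
by move=> /(_ measurableT [set true] I); rewrite setTI.
Qed.

Lemma measurable_nint u d : measurable_fun J (u \o G) ->
  measurable_fun [set: R * R]
    (fun z => (\1_[set z | sqdist z <= d] z * kern u z : R)).
Proof.
move=> mu'; apply: measurable_funM; last exact: measurable_kern.
by apply: measurable_indic; exact: measurable_near.
Qed.

(** By dominated convergence: the kernel vanishes at pairs of points with
    distance [0], where it is a quotient with denominator [0]. *)
Lemma cvg_nint u (d : nat -> R) : measurable_fun J (u \o G) ->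
  (kint u J < +oo)%E -> d @ \oo --> (0 : R) ->
  nint u (d n) @[n --> \oo] --> 0%E.
Proof.
move=> mu' fin d0.
have mk := measurable_kern mu'.
pose f_ n z := (\1_[set z | sqdist z <= d n] z * kern u z)%:E.
have m_ n : measurable_fun [set: R * R] (f_ n).
  by apply/measurable_EFinP; exact: measurable_nint.
have f_0 : {ae nu, forall z, [set: R * R] z -> f_ ^~ z @ \oo --> (cst 0%E z : \bar R)}.
  apply: aeW => z _; have [z0|z0] := eqVneq (sqdist z) 0.
    have k0 : kern u z = 0 by rewrite /kern z0 invr0 mulr0 !mul0r.
    by rewrite /f_ k0; under eq_fun do rewrite mulr0; exact: cvg_cst.
  apply: cvg_near_cst; near=> n; rewrite /f_ indicE memNset ?mul0r //=.
  apply/negP; rewrite -ltNge; near: n.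
  have z1 : 0 < sqdist z by rewrite lt_neqAle eq_sym z0 sqdist_ge0.
  by apply: (cvgr_lt _ d0).
have ig : nu.-integrable setT (fun z => (kern u z)%:E).
  apply/integrableP; split; first exact/measurable_EFinP.
  apply: le_lt_trans fin; rewrite /kint; apply: ge0_le_integral => //.
  - exact/measurableT_comp/measurable_EFinP.
  - by apply/measurable_EFinP; exact: measurable_kint.
  - by move=> z _; rewrite kern_supp /= ger0_norm ?kern_ge0.
have dom : {ae nu, forall z n, [set: R * R] z -> (`|f_ n z| <= (kern u z)%:E)%E}.
  apply: aeW => z n _; rewrite /= ger0_norm; last first.
    by rewrite mulr_ge0 ?kern_ge0 // indicE.
  by rewrite lee_fin ler_piMl ?kern_ge0 // indicE; case: (_ \in _).
have [_ _] := @dominated_convergence _ _ R nu setT measurableT f_ (cst 0%E)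
  (fun z => (kern u z)%:E) m_ (measurable_cst _) f_0 ig dom.
by rewrite integral0.
Unshelve. all: by end_near. Qed.

(** A bound by [nint] for a family of squares close to the diagonal, at most
    two of which overlap up to finitely many parameters. *)
Lemma sum_kint_near u (T : choiceType) (s : seq T) (A : T -> set R) (S : seq R) d :
  measurable_fun J (u \o G) -> (forall z, measurable (A z)) ->
  (forall x, x \notin S -> \sum_(z <- s) \1_(A z) x <= 2 :> R) ->
  (forall z x y, z \in s -> A z x -> A z y -> sqdist (x, y) <= d) ->
  (\sum_(z <- s) kint u (A z) <= 2%:E * nint u d)%E.
Proof.
move=> mu' mA ov near.
rewrite /kint -ge0_integral_sum //; last 2 first.
- by move=> z; apply/measurable_EFinP; exact: measurable_kint.
- by move=> z x _; rewrite lee_fin kint_ge0.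
have mn := measurable_nint d mu'.
rewrite /nint -ge0_integralZl //; last 2 first.
- exact/measurable_EFinP.
- by move=> z _; rewrite lee_fin mulr_ge0 ?kern_ge0 // indicE.
apply: ae_ge0_le_integral => //.
- by move=> z _; apply: sume_ge0 => i _; rewrite lee_fin kint_ge0.
- by apply: emeasurable_sum => i; apply/measurable_EFinP; exact: measurable_kint.
- by move=> z _; rewrite mule_ge0 // lee_fin mulr_ge0 ?kern_ge0 // indicE.
- by apply: measurable_funeM; exact/measurable_EFinP.
have mS : measurable [set` S].
  apply: countable_measurable => [t|]; first exact: measurable_set1.
  exact/finite_set_countable/finite_seq.
exists ([set` S] `*` setT); split.
- exact: measurableX.
- transitivity (mu [set` S] * mu setT)%E; first exact: product_measure1E.
  by rewrite countable_lebesgue_measure0 ?mul0e //; exact/finite_set_countable/finite_seq.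
move=> [x y] /= h; split => //; apply: contrapT => /negP xS; apply: h => _.
rewrite sumEFin -EFinM lee_fin mulrA.
under eq_bigr do rewrite -mulrA.
rewrite (@le_trans _ _ (\sum_(z <- s) \1_(A z) x *
  (\1_[set z | sqdist z <= d] (x, y) * kern u (x, y)))) //.
  rewrite big_seq [leRHS]big_seq; apply: ler_sum => z zs; rewrite !indicE.
  have [xA|xA] := boolP (x \in A z); have [yA|yA] := boolP (y \in A z);
    rewrite ?mul0r ?mulr0 ?mul1r ?mul0r //.
    by rewrite mem_set ?mul1r //=; exact: (near z _ _ zs (set_mem xA) (set_mem yA)).
  by rewrite mulr_ge0 ?kern_ge0.
rewrite -mulr_suml -mulrA ler_wpM2r ?ov //.
by rewrite mulr_ge0 ?kern_ge0 // indicE.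
Qed.

End kernel.

(** * The space H^{1/2} and its dual *)
Section H12space.
Context {R : realType} {G : curve R} {Omega : set (R * R)}.
Context (hG : boundary_curve G Omega).
Local Notation a := (ca G).
Local Notation b := (cb G).
Local Notation mu := (@lebesgue_measure R).
Local Notation J := (`[a, b]%classic : set R).
Local Notation kern := (@kern R G).
Local Notation kint := (@kint R G).
Local Notation nint := (@nint R G).
Implicit Types u v : R * R -> R.

Let mspeed : measurable_fun J (speed G). Proof. by case: (bd_speed hG). Qed.
Let mJ : measurable J. Proof. exact: measurable_itv. Qed.

Lemma preim_Gam : J `&` G @^-1` Gam G = J.
Proof. by apply/seteqP; split => [t []//|t Jt]; split=> //; exists t. Qed.

Lemma normL2sqE u :
  normL2sq G u = (\int[mu]_(t in J) ((u (G t)) ^+ 2 * speed G t)%:E)%E.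
Proof. by rewrite /normL2sq /arcint preim_Gam; apply: eq_integral. Qed.

Lemma measurable_sq u : measurable_fun J (u \o G) ->
  measurable_fun J (fun t => (u (G t)) ^+ 2 * speed G t).
Proof. by move=> mu'; apply: measurable_funM => //; exact: measurable_funX. Qed.

Lemma sq_ge0 u t : 0 <= (u (G t)) ^+ 2 * speed G t.
Proof. by rewrite mulr_ge0 ?sqr_ge0 ?speed_ge0. Qed.

Lemma normL2sq_ge0 u : (0 <= normL2sq G u)%E.
Proof. by rewrite normL2sqE; apply: integral_ge0 => t _; rewrite lee_fin sq_ge0. Qed.

Lemma semisq_Gam u : measurable_fun J (u \o G) -> semisq G (Gam G) u = kint u J.
Proof. by move=> mu'; rewrite (semisq_kint hG) ?preim_Gam. Qed.

Lemma kint_J_ge0 u A : (0 <= kint u A)%E.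
Proof. by apply: integral_ge0 => z _; rewrite lee_fin kint_ge0. Qed.

Lemma kint_sub u A B : measurable_fun J (u \o G) -> measurable A ->
  measurable B -> A `<=` B -> (kint u A <= kint u B)%E.
Proof.
move=> mu' mA mB AB; apply: ge0_le_integral => //.
- by move=> z _; rewrite lee_fin kint_ge0.
- by apply/measurable_EFinP; exact: (measurable_kint hG).
- by apply/measurable_EFinP; exact: (measurable_kint hG).
move=> z _; rewrite lee_fin ler_wpM2r ?kern_ge0 // !indicE.
have [zA|] := boolP (z.1 \in A); have [zA'|] := boolP (z.2 \in A);
  rewrite ?mul0r ?mulr0 ?mulr_ge0 //.
by rewrite !mem_set //; apply: AB; exact: set_mem.
Qed.

Lemma nint_le u d : measurable_fun J (u \o G) -> (nint u d <= kint u J)%E.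
Proof.
move=> mu'; apply: ge0_le_integral => //.
- by move=> z _; rewrite lee_fin mulr_ge0 ?kern_ge0 // indicE.
- by apply/measurable_EFinP; exact: (measurable_nint hG).
- by apply/measurable_EFinP; exact: (measurable_kint hG).
move=> z _; rewrite lee_fin kern_supp indicE.
by case: (z \in _); rewrite ?mul1r ?mul0r ?kern_ge0.
Qed.

Lemma H12_meas u : H12 G u -> measurable_fun J (u \o G).
Proof. by case=> [[]]. Qed.

Lemma H12_kint u : H12 G u -> (kint u J < +oo)%E.
Proof. by move=> [[mu' _] ?]; rewrite -semisq_Gam. Qed.

Lemma H12_comb (c : R) u v : H12 G u -> H12 G v -> H12 G (fun x => c * u x + v x).
Proof.
move=> [[mu' lu] su] [[mv lv] sv].
have mc : measurable_fun J ((fun x => c * u x + v x) \o G) by exact: measurable_comb.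
split; last first.
  rewrite !semisq_Gam // in su sv *.
  apply: le_lt_trans (kint_comb hG c mJ mu' mv) _.
  by apply: lte_add_pinfty; rewrite lte_mul_pinfty // lee_fin mulr_ge0 // sqr_ge0.
split => //; rewrite !normL2sqE in lu lv *.
apply: (@le_lt_trans _ _ (\int[mu]_(t in J)
  ((2 * c ^+ 2)%:E * ((u (G t)) ^+ 2 * speed G t)%:E +
   2%:E * ((v (G t)) ^+ 2 * speed G t)%:E)))%E.
  apply: ge0_le_integral => //.
  - by move=> t _; rewrite lee_fin mulr_ge0 ?sqr_ge0 ?speed_ge0.
  - by apply/measurable_EFinP; exact: (measurable_sq mc).
  - by apply: emeasurable_funD; apply: measurable_funeM;
      apply/measurable_EFinP; exact: measurable_sq.
  move=> t _; rewrite -!EFinM -EFinD lee_fin !mulrA -mulrDl ler_wpM2r ?speed_ge0 //.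
  have := sqr_ge0 (c * u (G t) - v (G t)); nra.
rewrite ge0_integralD //; last 4 first.
- by move=> t _; rewrite -EFinM lee_fin mulr_ge0 ?sq_ge0 // mulr_ge0 ?sqr_ge0.
- by apply: measurable_funeM; apply/measurable_EFinP; exact: measurable_sq.
- by move=> t _; rewrite -EFinM lee_fin mulr_ge0 ?sq_ge0.
- by apply: measurable_funeM; apply/measurable_EFinP; exact: measurable_sq.
have Z (k : R) (w : R * R -> R) : 0 <= k -> measurable_fun J (w \o G) ->
    (\int[mu]_(t in J) (k%:E * ((w (G t)) ^+ 2 * speed G t)%:E) =
     k%:E * \int[mu]_(t in J) ((w (G t)) ^+ 2 * speed G t)%:E)%E.
  move=> k0 mw; apply: ge0_integralZl => //.
  - by apply/measurable_EFinP; exact: measurable_sq.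
  - by move=> t _; rewrite lee_fin sq_ge0.
have c2 : 0 <= 2 * c ^+ 2 by rewrite mulr_ge0 // sqr_ge0.
rewrite (Z _ u) ?(Z _ v) //.
by apply: lte_add_pinfty; rewrite lte_mul_pinfty // lee_fin mulr_ge0 // sqr_ge0.
Qed.

Lemma kint_0 : kint (fun=> 0) J = 0%E.
Proof.
rewrite /kint integral0_eq // => z _.
suff -> : kern (fun=> 0) z = 0 by rewrite mulr0.
rewrite /kern; suff E t : (((fun=> 0) \o G) \_ J) t = 0 :> R.
  by rewrite !E subrr expr0n !mul0r.
by rewrite patchE; case: ifP.
Qed.

Lemma H12_0 : H12 G (fun=> 0).
Proof.
have m0 : measurable_fun J ((fun=> 0 : R) \o G) by exact: measurable_cst.
split; last by rewrite semisq_Gam // kint_0.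
split=> //; rewrite normL2sqE integral0_eq // => t _.
by rewrite expr0n mul0r.
Qed.

(** ** Equality almost everywhere *)

Lemma kint_aeq u v : measurable_fun J (u \o G) -> measurable_fun J (v \o G) ->
  aeq G u v -> kint u J = kint v J.
Proof.
move=> mu' mv [N [mN N0 hN]].
have bad t : t \notin N -> t \in `[a, b] -> u (G t) = v (G t).
  move=> tN; apply: contrapT => h; move/negP: tN; apply.
  by apply/mem_set/hN => h'; apply: h => /h'.
apply: ae_eq_integral => //.
- by apply/measurable_EFinP; exact: (measurable_kint hG).
- by apply/measurable_EFinP; exact: (measurable_kint hG).
have E t : t \notin N -> ((u \o G) \_ J) t = ((v \o G) \_ J) t.
  move=> tN; rewrite !patchE; case: ifP => // tJ /=; apply: bad => //.
  by move: tJ; rewrite inE.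
exists (N `*` setT `|` setT `*` N); split.
- by apply: measurableU; exact: measurableX.
- apply/eqP; rewrite eq_le measure_ge0 andbT.
  have z1 : ((mu \x mu)%E (N `*` setT) <= 0)%E.
    suff -> : (mu \x mu)%E (N `*` setT) = 0%E by [].
    by transitivity (mu N * mu setT)%E; [exact: product_measure1E | rewrite N0 mul0e].
  have z2 : ((mu \x mu)%E (setT `*` N) <= 0)%E.
    suff -> : (mu \x mu)%E (setT `*` N) = 0%E by [].
    by transitivity (mu setT * mu N)%E; [exact: product_measure1E | rewrite N0 mule0].
  have := leeD z1 z2; rewrite adde0; apply: le_trans.
  by apply: measureU2; exact: measurableX.
move=> [s t] /= h.
have [sN|sN] := boolP (s \in N); first by left; split=> //; exact: set_mem.
have [tN|tN] := boolP (t \in N); first by right; split=> //; exact: set_mem.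
by exfalso; apply: h => _; rewrite /kern /= !E.
Qed.

Lemma normL2sq_aeq u v : measurable_fun J (u \o G) -> measurable_fun J (v \o G) ->
  aeq G u v -> normL2sq G u = normL2sq G v.
Proof.
move=> mu' mv uv; rewrite !normL2sqE; apply: ae_eq_integral => //.
- by apply/measurable_EFinP; exact: measurable_sq.
- by apply/measurable_EFinP; exact: measurable_sq.
case: uv => N [mN N0 hN]; exists N; split => // t /= h; apply: hN => h'.
by apply: h => Jt; rewrite h'.
Qed.

Lemma normH12_aeq u v : H12 G u -> H12 G v -> aeq G u v ->
  normH12 G u = normH12 G v.
Proof.
move=> hu hv uv; rewrite /normH12 !semisq_Gam; try exact: H12_meas.
by rewrite (normL2sq_aeq _ _ uv) ?(kint_aeq _ _ uv) //; exact: H12_meas.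
Qed.

Lemma normH12_sqr u : H12 G u ->
  normH12 G u ^+ 2 = fine (normL2sq G u) + fine (kint u J).
Proof.
move=> hu; have [[mu' lu] _] := hu.
rewrite /normH12 semisq_Gam // fineD; last 2 first.
- by rewrite ge0_fin_numE ?normL2sq_ge0.
- by rewrite ge0_fin_numE ?kint_J_ge0 // H12_kint.
by rewrite sqr_sqrtr // addr_ge0 // fine_ge0 ?normL2sq_ge0 ?kint_J_ge0.
Qed.

Lemma normH12_ge0 u : 0 <= normH12 G u. Proof. exact: sqrtr_ge0. Qed.

Lemma normH12_0 : normH12 G (fun=> 0) = 0.
Proof.
apply/eqP; rewrite -sqrf_eq0 normH12_sqr; last exact: H12_0.
have -> : normL2sq G (fun=> 0) = 0%E.
  by rewrite normL2sqE integral0_eq // => t _; rewrite expr0n mul0r.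
by rewrite kint_0 addr0.
Qed.

(** ** Functionals *)

Lemma dual_aeq psi u v : dual G psi -> H12 G u -> H12 G v -> aeq G u v ->
  psi u = psi v.
Proof.
move=> [lin [C bd]] hu hv uv; apply/eqP; rewrite -subr_eq0 addrC -mulN1r -lin //.
have hd : H12 G (fun x => -1 * v x + u x) by exact: H12_comb.
rewrite -normr_eq0 eq_le normr_ge0 andbT; apply: le_trans (bd _ hd) _.
rewrite (normH12_aeq hd H12_0) ?normH12_0 ?mulr0 //.
case: uv => N [mN N0 hN]; exists N; split => // t /= h; apply: hN => h'.
by apply: h => Jt; rewrite h' // mulN1r addNr.
Qed.

Lemma dual_comb (c : R) psi chi : dual G psi -> dual G chi ->
  dual G (fun u => c * psi u + chi u).
Proof.
move=> [lp [C1 b1]] [lc [C2 b2]]; split => [k u v hu hv|].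
  by rewrite lp // lc //; ring.
exists (`|c| * C1 + C2) => u hu; apply: le_trans (ler_normD _ _) _.
by rewrite normrM mulrDl lerD ?b2 // -mulrA ler_wpM2l ?b1.
Qed.

Lemma ipE Psi u :
  ip G Psi u = Rintegral mu J (fun t => Psi (G t) * u (G t) * speed G t).
Proof. by rewrite /ip /arcint preim_Gam. Qed.

Lemma integrable_speed (C : R) : mu.-integrable J (fun t => (C * speed G t)%:E).
Proof.
have [_ [B hB]] := bd_speed hG.
have fJ : (mu J < +oo)%E.
  by rewrite lebesgue_measure_itv /=; case: ifP => // _; rewrite -EFinB ltry.
change (mu.-integrable J (EFin \o (fun t => C * speed G t))).
apply: (@measurable_bounded_integrable _ _ R mu (fun t => C * speed G t) J mJ fJ).
- by apply: measurable_funM.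
exists (`|C| * B); split; first exact: num_real.
move=> x xB t Jt; rewrite /= normrM (ger0_norm (speed_ge0 _ _)).
by apply: le_trans (ltW xB); rewrite ler_wpM2l // hB.
Qed.

Lemma integrable_sq (c : R) u : H12 G u ->
  mu.-integrable J (fun t => (c * (u (G t) ^+ 2 * speed G t))%:E).
Proof.
move=> [[mu' lu] _].
change (mu.-integrable J (fun t => (c%:E * ((u (G t)) ^+ 2 * speed G t)%:E)%E)).
apply: integrableZl => //; apply/integrableP; split.
  by apply/measurable_EFinP; exact: measurable_sq.
rewrite normL2sqE in lu; apply: le_lt_trans lu.
apply: ge0_le_integral => //.
- by apply: measurableT_comp => //; apply/measurable_EFinP; exact: measurable_sq.
- by apply/measurable_EFinP; exact: measurable_sq.
- by move=> t _; rewrite /= ger0_norm ?sq_ge0.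
Qed.

Lemma integrable_speed_sq (C c : R) u : H12 G u ->
  mu.-integrable J (fun t => (C * speed G t + c * (u (G t) ^+ 2 * speed G t))%:E).
Proof.
move=> hu.
exact: (@integrableD _ _ R mu J mJ _ _ (integrable_speed C) (integrable_sq c hu)).
Qed.

Lemma pairing_le (l C p w s : R) : 0 < l -> `|p| <= C -> 0 <= s ->
  `|p * w * s| <= l * C ^+ 2 / 2 * s + (l^-1 / 2) * (w ^+ 2 * s).
Proof.
move=> l0 pC s0; rewrite [X in _ + X]mulrA -mulrDl normrM (ger0_norm s0) ler_wpM2r //.
have C0 : 0 <= C by apply: le_trans pC.
rewrite normrM; apply: (@le_trans _ _ (C * `|w|)); first by rewrite ler_wpM2r.
rewrite -(real_normK (num_real w)); move: `|w| (normr_ge0 w) => x x0.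
have -> : l * C ^+ 2 / 2 + l^-1 / 2 * x ^+ 2 =
    C * x + l / 2 * (C - l^-1 * x) ^+ 2 by field; rewrite gt_eqF.
by rewrite lerDl mulr_ge0 ?sqr_ge0 // divr_ge0 // ltW.
Qed.

(** Bounded functions act on H^{1/2} through the scalar product of L^2. *)
Lemma dual_ip (Psi : R * R -> R) : measurable_fun J (Psi \o G) ->
  (exists C : R, forall t, t \in `[a, b] -> `|Psi (G t)| <= C) -> dual G (ip G Psi).
Proof.
move=> mP [C hC].
have ii u : H12 G u ->
    mu.-integrable J (fun t => (Psi (G t) * u (G t) * speed G t)%:E).
  move=> hu.
  have ig := integrable_speed_sq (1 * C ^+ 2 / 2) (1^-1 / 2) hu.
  apply: (@le_integrable _ _ R mu J mJ _ _ _ _ ig).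
    apply/measurable_EFinP; apply: measurable_funM => //.
    by apply: measurable_funM => //; exact: H12_meas.
  move=> t Jt /=; rewrite lee_fin; apply: le_trans (ler_norm _).
  by apply: pairing_le => //; [exact: hC | exact: speed_ge0].
split=> [c u v hu hv|].
  rewrite !ipE -RintegralZl //; last exact: ii.
  rewrite -RintegralD //; last 2 first.
  - rewrite (_ : EFin \o _ = fun t => (c%:E * (Psi (G t) * u (G t) * speed G t)%:E)%E) //.
    by apply: integrableZl => //; exact: ii.
  - exact: ii.
  by apply: eq_Rintegral => t _; ring.
set K := Rintegral mu J (fun t => C ^+ 2 * speed G t).
have K0 : 0 <= K.
  by apply: Rintegral_ge0 => t _; rewrite mulr_ge0 ?sqr_ge0 ?speed_ge0.
have main u (l : R) : H12 G u -> 0 < l ->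
    `|ip G Psi u| <= (l * K + l^-1 * fine (normL2sq G u)) / 2.
  move=> hu l0; rewrite ipE; apply: le_trans (le_normr_Rintegral _ _) _ => //.
    exact: ii.
  have E : fine (normL2sq G u) = Rintegral mu J (fun t => u (G t) ^+ 2 * speed G t).
    by rewrite normL2sqE.
  have i1 : mu.-integrable J (EFin \o (fun t => u (G t) ^+ 2 * speed G t)).
    have -> : EFin \o (fun t => u (G t) ^+ 2 * speed G t) =
        (fun t => (1 * (u (G t) ^+ 2 * speed G t))%:E).
      by apply/funext => t; rewrite /= mul1r.
    exact: integrable_sq.
  rewrite [leRHS](_ : _ = Rintegral mu J (fun t =>
      l * C ^+ 2 / 2 * speed G t + (l^-1 / 2) * (u (G t) ^+ 2 * speed G t))).
    apply: le_Rintegral => //.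
    - exact/integrable_norm/ii.
    - exact: integrable_speed_sq.
    move=> t Jt; apply: pairing_le => //; [exact: hC | exact: speed_ge0].
  rewrite RintegralD //; [|exact: integrable_speed | exact: integrable_sq].
  have -> : Rintegral mu J (fun t => l^-1 / 2 * (u (G t) ^+ 2 * speed G t)) =
      l^-1 / 2 * fine (normL2sq G u) by rewrite E RintegralZl.
  have -> : Rintegral mu J (fun t => l * C ^+ 2 / 2 * speed G t) = l / 2 * K.
    rewrite /K -RintegralZl //; last exact: integrable_speed.
    by apply: eq_Rintegral => t _; field.
  by field; rewrite gt_eqF.
exists ((K + 1) / 2) => u hu.
set n := fine (normL2sq G u) in main *.
have n0 : 0 <= n by rewrite fine_ge0 ?normL2sq_ge0.
have nle : Num.sqrt n <= normH12 G u.
  rewrite -[leRHS]ger0_norm ?normH12_ge0 // -sqrtr_sqr ler_sqrt ?sqr_ge0 //.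
  by rewrite normH12_sqr // lerDl fine_ge0 ?kint_J_ge0.
apply: le_trans (_ : (K + 1) / 2 * Num.sqrt n <= _); last first.
  by rewrite ler_wpM2l // divr_ge0 // addr_ge0.
have [n1|n1] := eqVneq n 0; last first.
  have np : 0 < n by rewrite lt_neqAle eq_sym n1.
  apply: le_trans (main u (Num.sqrt n) hu _) _; rewrite ?sqrtr_gt0 //.
  rewrite -[X in _^-1 * X](sqr_sqrtr n0) expr2 mulrA mulVf ?mul1r;
    last by rewrite gt_eqF ?sqrtr_gt0.
  by rewrite le_eqVlt; apply/orP; left; apply/eqP; field.
(* If the L^2 norm vanishes, the weight can be chosen arbitrarily small. *)
rewrite n1 sqrtr0 mulr0; apply/ler_addgt0Pl => e e0.
apply: le_trans (main u (e / (K + 1)) hu _) _.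
  by rewrite divr_gt0 // ltr_wpDl.
have K1 : 0 < K + 1 by rewrite ltr_wpDl.
have : e / (K + 1) * K <= e by rewrite mulrAC ler_pdivrMr // ler_pM2l // lerDl.
by rewrite -/n n1 mulr0; lra.
Qed.

End H12space.

(** * A potential that decreases under refinement *)
Section potential.
Context {R : realType}.
Context (kap : R) (p : nat) (kap_ge1 : 1 <= kap).
Implicit Types (x y u v : R * nat) (s : seq (R * nat)).

Local Notation len u v := (v.1 - u.1).

(** [u] and [v] are consecutive in [s]. *)
Definition adj s u v := exists s1 s2, s = s1 ++ u :: v :: s2.

Lemma adj_cons s x u v : adj s u v -> adj (x :: s) u v.
Proof. by move=> [s1 [s2 ->]]; exists (x :: s1), s2. Qed.

Lemma adj_catr s s' u v : adj s u v -> adj (s' ++ s) u v.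
Proof. by move=> [s1 [s2 ->]]; exists (s' ++ s1), s2; rewrite catA. Qed.

Lemma adj_consE x y s u v : adj (x :: y :: s) u v ->
  (u = x /\ v = y) \/ adj (y :: s) u v.
Proof.
move=> [[|z s1] [s2 /=]] []; first by move=> -> -> _; left.
by move=> _ e; right; exists s1, s2.
Qed.

Lemma adj1 x u v : ~ adj [:: x] u v.
Proof. by move=> [[|z [|z' s1]] [s2]]. Qed.

(** The lengths of neighbouring cells are comparable up to the factor [kap]. *)
Definition quasi_uniform s := forall u v w, (exists s1 s2, s = s1 ++ u :: v :: w :: s2) ->
  len u v <= kap * len v w /\ len v w <= kap * len u v.

(** The constant in the weight of [potc]. *)
Definition potC : R := (2 * p.+1%:R + 1) * (1 + kap).

(** The contribution of one cell. *)
Definition potc u v : R := (len u v) ^+ 2 * (potC - u.2%:R - v.2%:R).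

(** The sum over the cells of the mesh [x :: s] of the squared length times a
    weight that decreases with the multiplicities of the two end points.  The
    constant in the weight is so large that splitting a cell lowers the sum
    although the new nodes may have small multiplicity. *)
Fixpoint pot x s : R := if s is y :: s' then potc x y + pot y s' else 0.

Lemma pot_cat x s1 s2 : pot x (s1 ++ s2) = pot x s1 + pot (last x s1) s2.
Proof. by elim: s1 x => [|y s1 IH] x /=; rewrite ?add0r // IH addrA. Qed.

(** The order of the nodes by their parameters. *)
Definition ltpar : rel (R * nat) := fun u v => u.1 < v.1.

Lemma ltpar_trans : transitive ltpar.
Proof. by move=> y x z; exact: lt_trans. Qed.

(** All multiplicities lie between [1] and [p.+1]. *)
Definition mults s := {in s, forall y, (1 <= y.2 <= p.+1)%N}.

Lemma potC_ge : 2 * p.+1%:R + 1 <= potC.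
Proof.
have h : (0 : R) <= p.+1%:R by [].
have k1 := kap_ge1; move: h; rewrite /potC; move: p.+1%:R => P h.
by rewrite mulrDr mulr1 lerDl mulr_ge0 //; lra.
Qed.

Lemma mults_real y s : mults s -> y \in s ->
  (1 <= y.2%:R :> R) && (y.2%:R <= p.+1%:R :> R).
Proof. by move=> ms /ms; rewrite !ler_nat -[1%R]/(1%:R) ler_nat. Qed.

Lemma potc_ge0 u v s : mults s -> u \in s -> v \in s -> 0 <= potc u v.
Proof.
move=> ms /(mults_real ms) hu /(mults_real ms) hv.
by rewrite mulr_ge0 ?sqr_ge0 //; have := potC_ge; lra.
Qed.

Lemma pot_ge0 x s : mults (x :: s) -> 0 <= pot x s.
Proof.
elim: s x => [|y s IH] x ms //=.
rewrite addr_ge0 ?(potc_ge0 ms) ?inE ?eqxx ?orbT //.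
by apply: IH => z zs; apply: ms; rewrite inE zs orbT.
Qed.

Lemma pot_bound x s (D : R) : 0 <= D -> mults (x :: s) -> path ltpar x s ->
  (forall u v, adj (x :: s) u v -> len u v <= D) ->
  pot x s <= (potC - 2) * D * len x (last x s).
Proof.
move=> D0; elim: s x => [|y s IH] x ms /=; first by rewrite subrr mulr0.
move=> /andP[xy ys] hD.
have hx := mults_real ms (mem_head _ _).
have hy : (1 <= y.2%:R :> R) && (y.2%:R <= p.+1%:R :> R).
  by apply: (mults_real ms); rewrite inE mem_head orbT.
have h1 : pot y s <= (potC - 2) * D * len y (last y s).
  apply: IH => //; first by move=> z zs; apply: ms; rewrite inE zs orbT.
  by move=> u v uv; apply: hD; exact: adj_cons.
have h2 : potc x y <= (potC - 2) * D * len x y.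
  have xy0 : 0 <= len x y by rewrite subr_ge0 ltW.
  have xyD : len x y <= D by apply: hD; exists [::], s.
  have C2 : 0 <= potC - 2 by have := potC_ge; lra.
  rewrite /potc expr2 -[leRHS]mulrA [leRHS]mulrC ler_pM ?mulr_ge0 //.
  - by have := potC_ge; lra.
  - by rewrite ler_wpM2r.
  - by lra.
by apply: le_trans (lerD h2 h1) _; rewrite le_eqVlt; apply/orP; left; apply/eqP; ring.
Qed.

Lemma path_bounds x s z : path ltpar x s -> z \in x :: s ->
  x.1 <= z.1 <= (last x s).1.
Proof.
elim: s x z => [|y s IH] x z /=.
  by move=> _; rewrite inE => /eqP ->; rewrite lexx.
move=> /andP[xy ys]; rewrite inE => /predU1P[->|zs].
  have /andP[_ h] := IH y y ys (mem_head _ _).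
  by rewrite lexx (le_trans _ h) // ltW.
by have /andP[h1 ->] := IH y z ys zs; rewrite (le_trans _ h1) // ltW.
Qed.

(** By quasi-uniformity, cutting an interval into at least two cells reduces
    the length by a fixed factor. *)
Lemma cell_reduce x s u v : quasi_uniform (x :: s) -> path ltpar x s ->
  (1 < size s)%N -> adj (x :: s) u v ->
  len u v <= kap / (1 + kap) * len x (last x s).
Proof.
move=> qu xs s2 [s1 [s2' E]]; have k1 := kap_ge1.
have mem z : z \in s1 ++ u :: v :: s2' -> x.1 <= z.1 <= (last x s).1.
  by rewrite -E; exact: path_bounds.
have [N [h1 h2]] : exists N, len u v <= kap * N /\ len u v + N <= len x (last x s).
  case: s2' E mem => [|w s2'] E mem.
    case/lastP: s1 E mem => [|s1 w] E mem.
      by case: E s2 => _ ->.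
    exists (len w u).
    have [|_ h] := qu w u v; first by exists s1, [::]; rewrite E cat_rcons.
    split=> //; have /andP[hw _] : x.1 <= w.1 <= (last x s).1.
      by apply: mem; rewrite cat_rcons mem_cat inE eqxx orbT.
    have /andP[_ hv] : x.1 <= v.1 <= (last x s).1.
      by apply: mem; rewrite cat_rcons mem_cat !inE eqxx !orbT.
    lra.
  exists (len v w); have [|h _] := qu u v w; first by exists s1, s2'.
  split=> //; have /andP[hu _] : x.1 <= u.1 <= (last x s).1.
    by apply: mem; rewrite mem_cat inE eqxx orbT.
  have /andP[_ hw] : x.1 <= w.1 <= (last x s).1.
    by apply: mem; rewrite mem_cat !inE eqxx !orbT.
  lra.
rewrite mulrAC ler_pdivlMr; last by lra.
by move: (len u v) (len x _) h1 h2 => L D h1 h2; nra.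
Qed.

(** The cells from [x'] to [y'] of a refined mesh replace the single cell from
    [x] to [y]. *)
Lemma pot_block x y x' y' s1 : x.1 = x'.1 -> y.1 = y'.1 ->
  (x.2 <= x'.2)%N -> (y.2 <= y'.2)%N -> x.1 < y.1 ->
  mults [:: x; y] -> mults (x' :: rcons s1 y') ->
  path ltpar x' (rcons s1 y') -> quasi_uniform (x' :: rcons s1 y') ->
  [/\ s1 = [::], x = x' & y = y'] \/
  pot x' (rcons s1 y') <= potc x y - (1 + kap)^-1 * len x y ^+ 2.
Proof.
move=> ex ey mx my xy m m' px' qu; have k1 := kap_ge1.
have hx := mults_real m (mem_head _ _).
have hy : (1 <= y.2%:R :> R) && (y.2%:R <= p.+1%:R :> R).
  by apply: (mults_real m); rewrite !inE eqxx orbT.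
have i1 : 0 <= (1 + kap)^-1 <= 1.
  by rewrite invr_ge0 invf_le1; [apply/andP; split; lra | lra].
case: s1 m' px' qu => [|z s1] m' px' qu.
  have [/andP[/eqP e1 /eqP e2]|ne] := boolP ((x.2 == x'.2) && (y.2 == y'.2)).
    by left; split=> //; [rewrite (surjective_pairing x) ex e1 -surjective_pairing|
      rewrite (surjective_pairing y) ey e2 -surjective_pairing].
  right; rewrite /= addr0 /potc -ex -ey.
  have : (x.2 + y.2).+1%:R <= (x'.2 + y'.2)%:R :> R.
    rewrite ler_nat; move: ne mx my; rewrite negb_and.
    by move: x.2 x'.2 y.2 y'.2 => *; lia.
  rewrite -addn1 !natrD => h; have := sqr_ge0 (len x y).
  by move: (_ ^+ 2) => h2 h20; nra.
right.
have L : last x' (rcons (z :: s1) y') = y' by rewrite last_rcons.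
have q0 : 0 <= kap / (1 + kap) by rewrite divr_ge0; lra.
have D0 : 0 <= kap / (1 + kap) * len x' y'.
  by rewrite mulr_ge0 // -ex -ey subr_ge0 ltW.
have := pot_bound D0 m' px'; rewrite L => h.
apply: le_trans (h _) _.
  move=> u v uv; rewrite -[in leRHS]L; apply: cell_reduce uv => //.
  by rewrite size_rcons.
rewrite -ex -ey /potc.
have -> : kap / (1 + kap) = 1 - (1 + kap)^-1 by field; lra.
(* The loss of the factor [kap / (1 + kap)] outweighs the possible gain in the
   weights. *)
have e : potC * (1 + kap)^-1 = 2 * p.+1%:R + 1 by rewrite /potC mulfK //; lra.
have := sqr_ge0 (len x y); rewrite expr2; move: (len x y) => l l0.
move: i1 e hx hy; move: potC (1 + kap)^-1 x.2%:R y.2%:R p.+1%:R => C i X Y P.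
move=> /andP[i0 i1] e /andP[X1 XP] /andP[Y1 YP].
have : (C - 2) * (1 - i) <= C - X - Y - i by rewrite mulrBl mulrBr e; lra.
move=> hh; have := ler_wpM2r l0 hh.
have -> : (C - 2) * ((1 - i) * l) * l = (C - 2) * (1 - i) * (l * l) by ring.
by move: (l * l) => l2; rewrite ?expr2 => h2; apply: le_trans h2 _; lra.
Qed.

(** A refined mesh has no larger potential, and every cell that is not kept
    with its multiplicities forces a decrease by a fixed multiple of its
    squared length. *)
Lemma pot_refine x s x' s' : x.1 = x'.1 -> (x.2 <= x'.2)%N ->
  path ltpar x s -> path ltpar x' s' ->
  {in s, forall y, exists y', [/\ y' \in s', y.1 = y'.1 & (y.2 <= y'.2)%N]} ->
  (last x s).1 = (last x' s').1 ->
  mults (x :: s) -> mults (x' :: s') -> quasi_uniform (x' :: s') ->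
  pot x' s' <= pot x s /\
  forall u v, adj (x :: s) u v -> adj (x' :: s') u v \/
    pot x' s' <= pot x s - (1 + kap)^-1 * len u v ^+ 2.
Proof.
elim: s x x' s' => [|y s IH] x x' s' ex mx /=.
  move=> _ px' _ el m m' qu.
  case: s' px' el m' qu => [|z s'] /=; first by split=> // u v /adj1.
  move=> /andP[xz zs] el.
  have /andP[_ h] := path_bounds zs (mem_head _ _).
  by have := lt_le_trans xz h; rewrite -el ex ltxx.
move=> /andP[xy ys] px' sub el m m' qu.
have k1 := kap_ge1.
have [y' [y's' ey my]] := sub y (mem_head _ _).
case/splitPr: y's' px' sub el m' qu => s1 s2.
rewrite -cat_rcons cat_path last_cat last_rcons => /andP[p1 p2] sub el m' qu.
have m1 : mults (x' :: rcons s1 y').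
  by move=> z zs; apply: m'; rewrite -cat_cons mem_cat zs.
have m2 : mults (y' :: s2).
  move=> z zs; apply: m'; rewrite inE mem_cat mem_rcons.
  by move: zs; rewrite !inE => /orP[->|->]; rewrite ?orbT.
have q1 : quasi_uniform (x' :: rcons s1 y').
  move=> u v w [a [b E]]; apply: qu; exists a, (b ++ s2).
  by rewrite -[LHS]/((x' :: rcons s1 y') ++ s2) E -catA.
have q2 : quasi_uniform (y' :: s2).
  move=> u v w [a [b E]]; apply: qu; exists (x' :: s1 ++ a), b.
  by rewrite cat_rcons E /= -catA.
have m0 : mults (y :: s) by move=> z zs; apply: m; rewrite inE zs orbT.
have sub2 : {in s, forall z, exists z', [/\ z' \in s2, z.1 = z'.1 & (z.2 <= z'.2)%N]}.
  move=> z zs; have [z' [z's' e1 e2]] := sub z (mem_behead (s := y :: s) zs).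
  exists z'; split=> //; move: z's'; rewrite mem_cat => /orP[z1|//].
  have lz : y.1 < z.1.
    by move: ys; rewrite (path_sortedE (@ltpar_trans)) => /andP[/allP /(_ _ zs)].
  have /andP[_] := path_bounds p1 (mem_behead (s := x' :: rcons s1 y') z1).
  by rewrite last_rcons -e1 -ey => h; have := lt_le_trans lz h; rewrite ltxx.
have [I1 I2] := IH y y' s2 ey my ys p2 sub2 el m0 m2 q2.
have mxy : mults [:: x; y].
  by move=> z; rewrite !inE => /orP[]/eqP ->; apply: m; rewrite !inE eqxx ?orbT.
have B := pot_block ex ey mx my xy mxy m1 p1 q1.
have i0 : 0 <= (1 + kap)^-1 * len x y ^+ 2 by rewrite mulr_ge0 ?sqr_ge0 // invr_ge0; lra.
have B' : pot x' (rcons s1 y') <= potc x y.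
  by case: B => [[-> -> ->]|]; [rewrite /= addr0 | lra].
rewrite pot_cat last_rcons; split; first exact: lerD.
move=> u v /adj_consE[[-> ->]|/I2[uv|h]]; last 2 first.
- by left; rewrite cat_rcons -cat_cons; apply: adj_catr.
- by right; lra.
case: B => [[-> -> ->]|h]; last by right; lra.
by left; exists [::], s2.
Qed.

End potential.

(** * Meshes on the curve *)

Lemma subseq_map_in (T1 T2 : eqType) (f : T1 -> T2) (D : pred T1) s1 s2 :
  {in D &, injective f} -> all D s1 -> all D s2 ->
  subseq (map f s1) (map f s2) -> subseq s1 s2.
Proof.
move=> inj; elim: s2 s1 => [|y s2 IH] [|x s1] //= /andP[Dx D1] /andP[Dy D2].
case: (altP (f x =P f y)) => [/inj -> //|ne].
  by rewrite eqxx; exact: IH.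
case: eqP => [e|_]; first by rewrite e eqxx in ne.
by apply: (IH (x :: s1)) => //=; rewrite Dx.
Qed.

Section mesh_curve.
Context {R : realType} {G : curve R} {Omega : set (R * R)} {p : nat}.
Context (hG : boundary_curve G Omega).
Local Notation a := (ca G).
Local Notation b := (cb G).
Local Notation mu := (@lebesgue_measure R).
Local Notation J := (`[a, b]%classic : set R).
Implicit Types T : mesh R.

(** The parametrization is injective up to the two end points. *)
Lemma curve_inj s t : s \in `[a, b] -> t \in `[a, b] -> G s = G t ->
  s = t \/ (s = a \/ s = b) /\ (t = a \/ t = b).
Proof.
case: hG => ab _ _ H _; case: ifP H => _; last first.
  by move=> [_ [_ inj _]] sJ tJ e; left; apply: inj; rewrite ?inE.
move=> [_ Gab [_ inj _]] sJ tJ e.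
pose r x := if x == b then a else x.
have rJ x : x \in `[a, b] -> r x \in `[a, b[.
  rewrite /r !in_itv /= => /andP[ax xb]; case: eqP => [_|/eqP n]; first by rewrite lexx.
  by rewrite ax lt_neqAle n.
have rG x : G (r x) = G x by rewrite /r; case: eqP => // ->.
have : r s = r t by apply: inj; rewrite ?inE; [exact: rJ|exact: rJ|rewrite !rG].
rewrite /r; case: eqP => [->|_]; case: eqP => [->|_] //; first by left.
- by move=> <-; right; split; [right|left].
- by move=> ->; right; split; [left|right].
by left.
Qed.

Lemma mesh_path T : is_mesh G p T ->
  exists s, T = (a, p.+1) :: s /\ path ltpar (a, p.+1) s /\
    last (a, p.+1) s = (b, p.+1).
Proof.
move=> mT; have [s E] := mesh_ends mT; exists (rcons s (b, p.+1)).
rewrite last_rcons; split=> //; split=> //.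
have := mesh_sorted mT; rewrite E /=.
by rewrite -[path ltpar _ _]/(path (relpre fst <%R) (a, p.+1) _) -path_map.
Qed.

Lemma mesh_itv T z : is_mesh G p T -> z \in T -> a <= z.1 <= b.
Proof.
move=> mT; have [s [-> [ps ls]]] := mesh_path mT => zs.
by have := path_bounds ps zs; rewrite ls.
Qed.

Lemma zparE T j : zpar T j = (nth (0, 0%N) T j).1.
Proof.
rewrite /zpar /unzip1; case: (ltnP j (size T)) => h; first by rewrite (nth_map (0, 0%N)).
by rewrite !nth_default ?size_map.
Qed.

Lemma mesh_multE T j : mult T j = (nth (0, 0%N) T j).2.
Proof.
rewrite /mult /unzip2; case: (ltnP j (size T)) => h; first by rewrite (nth_map (0, 0%N)).
by rewrite !nth_default ?size_map.
Qed.

Lemma ncells_lt T j : (j < ncells T)%N = (j.+1 < size T)%N.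
Proof. by rewrite /ncells; lia. Qed.

Lemma mesh_mults T : is_mesh G p T -> mults p T.
Proof.
move=> [n0 _ _ hm _] z zT; have := hm (index z T).
rewrite mesh_multE nth_index //; apply.
have h : (index z T < size T)%N by rewrite index_mem.
by rewrite /ncells -ltnS (ltn_predK h).
Qed.

Lemma adj_nth T u v : adj T u v <-> exists j, [/\ (j < ncells T)%N,
  u = nth (0, 0%N) T j & v = nth (0, 0%N) T j.+1].
Proof.
split=> [[s1 [s2 ->]]|[j [jT -> ->]]].
  exists (size s1); rewrite ncells_lt size_cat /= -addn2 leq_add2l; split=> //.
    by rewrite nth_cat ltnn subnn.
  by rewrite nth_cat ltnNge leqnSn /= subSn // subnn.
rewrite ncells_lt in jT; exists (take j T), (drop j.+2 T).
by rewrite -!drop_nth ?cat_take_drop //; lia.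
Qed.

Lemma ncells_size T j : is_mesh G p T -> (j <= ncells T)%N -> (j < size T)%N.
Proof.
case=> n0 _ _ _ _; rewrite -ltnS /ncells (ltn_predK (m := 0)) //.
by move: n0; rewrite /ncells; case: size.
Qed.

Lemma zpar_lt T i j : is_mesh G p T -> (i < j)%N -> (j <= ncells T)%N ->
  zpar T i < zpar T j.
Proof.
move=> mT ij jn; have sT := mesh_sorted mT.
by rewrite /zpar (sorted_ltn_nth lt_trans) // inE size_map;
  apply: (ncells_size mT) => //; exact: leq_trans (ltnW ij) jn.
Qed.

Lemma zpar_itv T j : is_mesh G p T -> (j <= ncells T)%N -> zpar T j \in `[a, b].
Proof.
move=> mT jn; rewrite in_itv zparE /=; apply: (mesh_itv mT); apply: mem_nth.
exact: (ncells_size mT).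
Qed.

(** ** Refinement of knots in the parameter domain *)

Lemma knots_map T :
  knots G T = map G (flatten [seq nseq zm.2 zm.1 | zm <- drop (cclosed G) T]).
Proof.
rewrite /knots map_flatten -map_comp; congr flatten; apply: eq_map => zm /=.
by rewrite map_nseq.
Qed.

(** The parametrization is injective on the parameters of the knots that are
    listed; in the closed case the remaining ones are [p.+1] copies of [a]. *)
Lemma pknots_subseq T T' : is_mesh G p T -> is_mesh G p T' ->
  subseq (knots G T) (knots G T') -> subseq (pknots T) (pknots T').
Proof.
rewrite !knots_map => mT mT'.
have [s [E [ps _]]] := mesh_path mT; have [s' [E' [ps' _]]] := mesh_path mT'.
have inJ T1 : is_mesh G p T1 -> forall x, x \in pknots T1 -> a <= x <= b.
  by move=> m1 x /flattenP[l /mapP[zm zT ->]] /nseqP[-> _]; exact: mesh_itv m1 zT.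
have gta s1 : path ltpar (a, p.+1) s1 -> forall x, x \in pknots s1 -> a < x.
  move=> p1 x /flattenP[l /mapP[zm zT ->]] /nseqP[-> _].
  by move: p1; rewrite (path_sortedE (@ltpar_trans R)) => /andP[/allP /(_ _ zT)].
case c: (cclosed G).
  rewrite E E' => h; rewrite /= !drop0 in h.
  suff sub : subseq (pknots s) (pknots s').
    exact: (cat_subseq (subseq_refl (nseq p.+1 a)) sub).
  apply: (@subseq_map_in _ _ G [pred x | a < x <= b]) h.
  - move=> x y /andP[ax xb] /andP[ay yb] /curve_inj [||//|].
    + by rewrite in_itv /= ltW.
    + by rewrite in_itv /= ltW.
    + by move=> [[e|e] [e'|e']]; move: ax ay; rewrite e e' ?ltxx.
  - apply/allP => x xs /=; rewrite (gta s) //.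
    have xT : x \in pknots T by rewrite E pknots_cons mem_cat xs orbT.
    by have /andP[] := inJ T mT x xT.
  - apply/allP => x xs /=; rewrite (gta s') //.
    have xT : x \in pknots T' by rewrite E' pknots_cons mem_cat xs orbT.
    by have /andP[] := inJ T' mT' x xT.
rewrite !drop0; apply: (@subseq_map_in _ _ G [pred x | a <= x <= b]).
- case: hG => ab _ _; rewrite c => -[_ [_ inj _]] _ x y xJ yJ; apply: inj;
    by rewrite inE /= in_itv.
- by apply/allP => x /(inJ T mT).
- by apply/allP => x /(inJ T' mT').
Qed.

Lemma pknots_gt (x : R * nat) s z : path ltpar x s -> z \in pknots s -> x.1 < z.
Proof.
move=> xs /flattenP[l /mapP[zm zT ->]] /nseqP[-> _].
by move: xs; rewrite (path_sortedE (@ltpar_trans R)) => /andP[/allP /(_ _ zT)].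
Qed.

Lemma count_pknots (x : R * nat) s z m : path ltpar x s -> (z, m) \in x :: s ->
  count_mem z (pknots (x :: s)) = m.
Proof.
have last_case (y : R * nat) t : path ltpar y t -> count_mem y.1 (pknots (y :: t)) = y.2.
  move=> yt; rewrite pknots_cons count_cat count_nseq /= eqxx mul1n.
  rewrite (count_memPn _) ?addn0 //; apply/negP => /(pknots_gt yt).
  by rewrite ltxx.
elim: s x => [|y s IH] x xs.
  by rewrite inE => /eqP e; have := last_case x [::] isT; rewrite -e.
rewrite inE => /predU1P[e|zs]; first by have := last_case x _ xs; rewrite -e.
have /andP[xy ys] : ltpar x y && path ltpar y s := xs.
rewrite pknots_cons count_cat (IH y ys zs) count_nseq /= lt_eqF ?mul0n //.
by have /andP[h _] := path_bounds ys zs; apply: lt_le_trans xy h.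
Qed.

(** Nodes remain, and their multiplicities do not decrease. *)
Lemma mesh_refine_sub T T' : is_mesh G p T -> is_mesh G p T' ->
  subseq (pknots T) (pknots T') -> forall y, y \in T ->
  exists y', [/\ y' \in T', y.1 = y'.1 & (y.2 <= y'.2)%N].
Proof.
move=> mT mT' sub [z m] yT.
have m0 : (0 < m)%N by have /andP[] := mesh_mults mT yT.
have [s [E [ps _]]] := mesh_path mT; have [s' [E' [ps' _]]] := mesh_path mT'.
have c : count_mem z (pknots T) = m by rewrite E; apply: count_pknots => //; rewrite -E.
have zT : z \in pknots T by rewrite -has_pred1 has_count c.
have /flattenP[l /mapP[[z' m'] zT' ->]] := mem_subseq sub zT.
move=> /nseqP[/= ez _]; rewrite -ez in zT'; exists (z, m'); split=> //=.
have c' : count_mem z (pknots T') = m'.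
  by rewrite E'; apply: count_pknots => //; rewrite -E'.
by rewrite -c -c'; exact: leq_count_subseq.
Qed.

(** ** Elements *)

(** The parameters of the points of an element form its cell, up to the ends of
    the parameter interval. *)
Lemma preim_elt_itv (c d t : R) : `[c, d] `<=` J -> t \in `[a, b] ->
  (G @` `[c, d]) (G t) -> t \in `[c, d] \/ (t = a \/ t = b).
Proof.
move=> cdJ tJ [t' t'cd /esym /curve_inj [||->|[h _]]] //; first exact: cdJ.
- by left.
- by right.
Qed.

Lemma preim_elt (c d : R) : `[c, d] `<=` J ->
  J `&` G @^-1` (G @` `[c, d]) =
  `[c, d] `|` ([set a; b] `&` (J `&` G @^-1` (G @` `[c, d]))).
Proof.
move=> cdJ; apply/seteqP; split => [t [tJ tE]|t [tcd|[_ //]]].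
  by case: (preim_elt_itv cdJ tJ tE) => [?|h]; [left|right].
by split; [exact: cdJ | exists t].
Qed.

Let finite_ab (E : set R) : finite_set ([set a; b] `&` E).
Proof. by apply: finite_setIl; exact: finite_set2. Qed.

Lemma measurable_preim_elt (c d : R) : `[c, d] `<=` J ->
  measurable (J `&` G @^-1` (G @` `[c, d])).
Proof.
move=> cdJ; rewrite preim_elt //; apply: measurableU => //.
apply: countable_measurable => [t|]; first exact: measurable_set1.
exact/finite_set_countable/finite_ab.
Qed.

Lemma hpar_elt (c d : R) : `[c, d] `<=` J -> c <= d ->
  hpar G (G @` `[c, d]) = d - c.
Proof.
move=> cdJ cd; have mE := measurable_preim_elt cdJ.
rewrite /hpar; suff -> : mu (J `&` G @^-1` (G @` `[c, d])) = (d - c)%:E by [].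
have mI : mu `[c, d] = (d - c)%:E.
  by rewrite lebesgue_measure_itv /= lte_fin; case: ltgtP cd => // -> _; rewrite subrr.
apply/eqP; rewrite eq_le; apply/andP; split; last first.
  rewrite -mI; apply: le_measure; rewrite ?inE //.
  by move=> t tcd; split; [exact: cdJ | exists t].
rewrite preim_elt // -mI.
set F := [set a; b] `&` _.
have cF : countable F by exact/finite_set_countable/finite_ab.
have mF : measurable F.
  by apply: countable_measurable => // t; exact: measurable_set1.
have F0 : (mu F <= 0)%E by rewrite countable_lebesgue_measure0.
have := leeD (lexx (mu `[c, d])) F0; rewrite adde0; apply: le_trans.
by apply: measureU2.
Qed.

Lemma cell_sub T j : is_mesh G p T -> (j < ncells T)%N ->
  `[zpar T j, zpar T j.+1] `<=` J.
Proof.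
move=> mT jn t /=; rewrite !in_itv /=.
have := zpar_itv mT (ltnW jn); have := zpar_itv mT jn.
rewrite !in_itv /= => /andP[h1 h2] /andP[h3 h4] /andP[h5 h6].
by rewrite (le_trans h3) // (le_trans h6).
Qed.

Lemma hpar_cell T j : is_mesh G p T -> (j < ncells T)%N ->
  hpar G (elt G T j) = zpar T j.+1 - zpar T j.
Proof.
move=> mT jn; rewrite /elt hpar_elt //; first exact: cell_sub.
by apply/ltW/(zpar_lt mT).
Qed.

Lemma hpar_cell_gt0 T j : is_mesh G p T -> (j < ncells T)%N ->
  0 < hpar G (elt G T j).
Proof. by move=> mT jn; rewrite hpar_cell // subr_gt0 (zpar_lt mT). Qed.

(** Two elements with a common point have comparable length. *)
Lemma kappa_le T (kap : R) i j : is_mesh G p T -> kappa G T <= kap ->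
  (i < ncells T)%N -> (j < ncells T)%N ->
  elt G T i `&` elt G T j !=set0 ->
  hpar G (elt G T i) <= kap * hpar G (elt G T j).
Proof.
move=> mT kle ilt jlt ij; rewrite -ler_pdivrMr ?hpar_cell_gt0 //.
apply: le_trans kle; apply: ub_le_sup; last first.
  by exists (elt G T i), (elt G T j); split; [exists i|exists j|..].
exists ((b - a) * \sum_(k < ncells T) (hpar G (elt G T k))^-1).
move=> _ [_ [_ [[k /= kn <-] [l /= ln <-] _ ->]]].
apply: ler_pM; [by apply/ltW/hpar_cell_gt0| | |].
- by rewrite invr_ge0; apply/ltW/hpar_cell_gt0.
- rewrite hpar_cell //; have := zpar_itv mT (ltnW kn); have := zpar_itv mT kn.
  by rewrite !in_itv /= => /andP[? ?] /andP[? ?]; lra.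
rewrite (bigD1 (Ordinal ln)) //= lerDl; apply: sumr_ge0 => m _.
by rewrite invr_ge0 ltW // hpar_cell_gt0.
Qed.

Lemma mesh_quasi_uniform T (kap : R) : is_mesh G p T -> kappa G T <= kap ->
  quasi_uniform kap T.
Proof.
move=> mT kle u v w [s1 [s2 E]].
have sz : size T = (size s1 + (size s2).+3)%N by rewrite E size_cat.
have j1 : (size s1 < ncells T)%N by rewrite ncells_lt sz; lia.
have j2 : ((size s1).+1 < ncells T)%N by rewrite ncells_lt sz; lia.
have nu : nth (0, 0%N) T (size s1) = u by rewrite E nth_cat ltnn subnn.
have nv : nth (0, 0%N) T (size s1).+1 = v.
  by rewrite E nth_cat ltnNge leqnSn /= subSn // subnn.
have nw : nth (0, 0%N) T (size s1).+2 = w.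
  by rewrite E nth_cat ltnNge -addn2 leq_addr /= addKn.
have meet : elt G T (size s1) `&` elt G T (size s1).+1 !=set0.
  exists (G (zpar T (size s1).+1)); split; exists (zpar T (size s1).+1) => //=;
    by rewrite in_itv /= lexx ?andbT ltW // (zpar_lt mT).
have h1 := kappa_le mT kle j1 j2 meet; rewrite setIC in meet.
have h2 := kappa_le mT kle j2 j1 meet.
by move: h1 h2; rewrite !hpar_cell // !zparE nu nv nw.
Qed.

End mesh_curve.

(** * Refined cells and patches *)
Section patches.
Context {R : realType} {G : curve R} {Omega : set (R * R)} {p : nat}.
Context (hG : boundary_curve G Omega).
Local Notation a := (ca G).
Local Notation b := (cb G).
Local Notation mu := (@lebesgue_measure R).
Local Notation J := (`[a, b]%classic : set R).
Implicit Types T : mesh R.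

(** The potential of a mesh; its first node is [a] with multiplicity [p.+1]. *)
Definition mesh_pot (kap : R) T : R := pot kap p (a, p.+1) (behead T).

Lemma mesh_pot_ge0 kap T : 1 <= kap -> is_mesh G p T -> 0 <= mesh_pot kap T.
Proof.
move=> k1 mT; have [s [E _]] := mesh_path mT.
have m := mesh_mults mT; rewrite E in m.
by rewrite /mesh_pot E; exact: (pot_ge0 k1).
Qed.

(** An element that does not recur with the same multiplicities is short if the
    potential drops only little. *)
Lemma mesh_pot_refine kap T T' : 1 <= kap -> is_mesh G p T -> is_mesh G p T' ->
  kappa G T' <= kap -> subseq (knots G T) (knots G T') ->
  mesh_pot kap T' <= mesh_pot kap T /\
  forall j, (j < ncells T)%N ->
    ~ belts G T' (elt G T j, mult T j, mult T j.+1) ->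
    (1 + kap)^-1 * hpar G (elt G T j) ^+ 2 <= mesh_pot kap T - mesh_pot kap T'.
Proof.
move=> k1 mT mT' kle sub.
have ps := pknots_subseq hG mT mT' sub.
have [s [E [pth lst]]] := mesh_path mT; have [s' [E' [pth' lst']]] := mesh_path mT'.
have qu := mesh_quasi_uniform hG mT' kle.
have m1 := mesh_mults mT; have m2 := mesh_mults mT'.
have sb : {in s, forall y, exists y', [/\ y' \in s', y.1 = y'.1 & (y.2 <= y'.2)%N]}.
  move=> y ys; have yT : y \in T by rewrite E inE ys orbT.
  have [y' [y'T e1 e2]] := mesh_refine_sub mT mT' ps yT.
  exists y'; split=> //; move: y'T; rewrite E' inE => /predU1P[ey|//].
  move: pth; rewrite (path_sortedE (@ltpar_trans R)) => /andP[/allP /(_ _ ys)].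
  by rewrite /ltpar e1 ey /= ltxx.
rewrite E in m1; rewrite E' in m2 qu.
have el : (last (a, p.+1) s).1 = (last (a, p.+1) s').1 by rewrite lst lst'.
have [P1 P2] := pot_refine k1 (erefl _) (leqnn _) pth pth' sb el m1 m2 qu.
have EP : mesh_pot kap T = pot kap p (a, p.+1) s by rewrite /mesh_pot E.
have EP' : mesh_pot kap T' = pot kap p (a, p.+1) s' by rewrite /mesh_pot E'.
rewrite EP EP'; split=> // j jn nb.
have aj : adj T (nth (0, 0%N) T j) (nth (0, 0%N) T j.+1) by apply/adj_nth; exists j.
have := P2 (nth (0, 0%N) T j) (nth (0, 0%N) T j.+1).
rewrite -E -E' => /(_ aj)[/adj_nth[k [kn ej ej1]]|].
  exfalso; apply: nb; exists k => //.
  by rewrite /elt !zparE !mesh_multE -ej -ej1.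
by rewrite -!zparE (hpar_cell hG mT jn); lra.
Qed.

(** The parameters of the points in the patch of [z]. *)
Definition patch_pre T z : set R := J `&` G @^-1` (Defs.patch G T z).

Lemma patch_preE T z : patch_pre T z =
  \bigcup_(j in [set j | (j < ncells T)%N /\ elt G T j z]) (J `&` G @^-1` elt G T j).
Proof.
apply/seteqP; split=> [t [tJ [_ [[j jn <-] zj] tj]]|t [j [jn zj] [tJ tj]]].
  by exists j.
by split=> //; exists (elt G T j) => //; split=> //; exists j.
Qed.

Lemma measurable_patch_pre T z : is_mesh G p T -> measurable (patch_pre T z).
Proof.
move=> mT; rewrite patch_preE; apply: fin_bigcup_measurable.
  by apply: sub_finite_set (finite_II (ncells T)) => j [].
by move=> j [jn _]; apply: (measurable_preim_elt hG); exact: (cell_sub mT).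
Qed.

(** If one element at the node [z] is short, the patch of [z] is small. *)
Lemma patch_small T (kap d e : R) z j : is_mesh G p T -> kappa G T <= kap ->
  0 <= kap -> 0 <= e ->
  (forall s t, s \in `[a, b] -> t \in `[a, b] -> `|s - t| <= d ->
    Defs.edist (G s) (G t) <= e) ->
  (j < ncells T)%N -> elt G T j z -> kap * hpar G (elt G T j) <= d ->
  forall s t, patch_pre T z s -> patch_pre T z t ->
    sqdist (G := G) (s, t) <= 4 * e ^+ 2.
Proof.
move=> mT kle k0 e0 mod jn zj hd.
have near s : patch_pre T z s -> Defs.edist (G s) z <= e.
  rewrite patch_preE => -[i [iN zi] [sJ [s' s'i es]]].
  have [zt zti ez] := zi; rewrite -es -ez; apply: mod.
  - exact: (cell_sub mT iN).
  - exact: (cell_sub mT iN).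
  apply: le_trans hd; apply: le_trans (kappa_le hG mT kle iN jn _); last by exists z.
  rewrite (hpar_cell hG mT iN); move: s'i zti.
  rewrite /= !in_itv /= => /andP[? ?] /andP[? ?].
  by rewrite ler_norml; apply/andP; split; lra.
move=> s t sA tA; have := near _ sA; have := near _ tA.
rewrite sqdistE; [|by case: sA|by case: tA].
have sq x y : Defs.edist x y <= e -> (x.1 - y.1) ^+ 2 + (x.2 - y.2) ^+ 2 <= e ^+ 2.
  move=> h; rewrite -[leLHS]sqr_sqrtr ?addr_ge0 ?sqr_ge0 //.
  by rewrite ler_pXn2r ?nnegrE ?sqrtr_ge0.
move=> /sq ht /sq hs; rewrite /Defs.edist /enorm sqr_sqrtr ?addr_ge0 ?sqr_ge0 //=.
move: (G s) (G t) ht hs => [s1 s2] [t1 t2] /=; case: (z) => z1 z2 /= ht hs.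
have := sqr_ge0 (s1 + t1 - 2 * z1); have := sqr_ge0 (s2 + t2 - 2 * z2); nra.
Qed.

Lemma mesh_locate T x : is_mesh G p T -> x \in `[a, b] ->
  exists2 i, (i < ncells T)%N & zpar T i <= x <= zpar T i.+1.
Proof.
move=> mT; rewrite in_itv /= => /andP[ax xb].
have [n0 _ [z0 zn] _ _] := mT.
have : x <= zpar T (ncells T) by rewrite zn.
have : (ncells T <= ncells T)%N by [].
elim: {1 3}(ncells T) => [_ h|k IH kn xk].
  by exists 0%N => //; rewrite {1}z0 ax (le_trans h) //; apply/ltW/(zpar_lt mT).
case: (leP x (zpar T k)) => h; first by apply: IH => //; exact: ltnW.
by exists k => //; rewrite (ltW h).
Qed.

(** A point that is not a node lies in the patches of the two end points of
    its element only. *)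
Lemma patch_overlap T (M : {fset R * R}) x : is_mesh G p T ->
  (M `<=` nodes G T)%fset -> x \notin unzip1 T ->
  \sum_(z <- M) \1_(patch_pre T z) x <= 2 :> R.
Proof.
move=> mT MN xT.
have [xJ|xJ] := boolP (x \in `[a, b]); last first.
  rewrite big1 // => z _; rewrite indicE memNset // => -[/= h _].
  by rewrite h in xJ.
have [i iN /andP[zx xz]] := mesh_locate mT xJ.
have nodeT k : (k <= ncells T)%N -> zpar T k \in unzip1 T.
  by move=> kn; apply: mem_nth; rewrite size_map; exact: (ncells_size mT).
have neq k : (k <= ncells T)%N -> x != zpar T k.
  by move=> /nodeT h; apply: contra xT => /eqP ->.
have [n0 _ [z0 zn] _ _] := mT.
have xa : x <> a by apply/eqP; rewrite -z0; apply: neq.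
have xb : x <> b by apply/eqP; rewrite -zn; apply: neq.
have cell k : (k < ncells T)%N -> elt G T k (G x) -> k = i.
  move=> kN /(preim_elt_itv hG (cell_sub mT kN) xJ)[|[//|//]].
  rewrite /= in_itv /= => /andP[h1 h2].
  apply/eqP; rewrite eqn_leq; apply/andP; split; rewrite leqNgt; apply/negP => ik.
    have : zpar T i.+1 <= zpar T k.
      move: ik; rewrite leq_eqVlt => /predU1P[->//|ik].
      by apply/ltW; apply: (zpar_lt mT) => //; exact: ltnW.
    move=> h; have := neq i.+1 iN.
    by rewrite (@le_anti _ _ x (zpar T i.+1)) ?eqxx // xz (le_trans h).
  have : zpar T k.+1 <= zpar T i.
    move: ik; rewrite leq_eqVlt => /predU1P[->//|ik].
    by apply/ltW; apply: (zpar_lt mT) => //; exact: ltnW.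
  move=> h; have := neq i (ltnW iN).
  by rewrite (@le_anti _ _ x (zpar T i)) ?eqxx // zx (le_trans h2).
have ends z : z \in M -> patch_pre T z x -> z = G (zpar T i) \/ z = G (zpar T i.+1).
  move=> zM; rewrite patch_preE => -[k [kN zk] [_ xk]].
  have ki := cell k kN xk; subst k.
  have : z \in nodes G T by exact: (fsubsetP MN).
  rewrite inE /= => /mapP[w /mem_drop wT ez].
  have [k kn ew] : exists2 k, (k <= ncells T)%N & w = zpar T k.
    exists (index w (unzip1 T)); last by rewrite /zpar nth_index.
    have : (index w (unzip1 T) < size T)%N by rewrite -(size_map fst) index_mem.
    by rewrite /ncells; case: (size T).
  rewrite ez in zk *; have [t tk et] := zk.
  have tJ : t \in `[a, b] by exact: (cell_sub mT kN tk).
  have wJ : w \in `[a, b] by rewrite ew; exact: (zpar_itv mT kn).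
  move: (tk); rewrite /= in_itv /= => /andP[t1 t2].
  have zi := zpar_itv mT (ltnW kN); have zi1 := zpar_itv mT kN.
  rewrite !in_itv /= in zi zi1.
  case: (curve_inj hG tJ wJ et) => [tw|[[ta|tb] _]]; last 2 first.
  - left; rewrite -et; congr (G _); apply/le_anti; rewrite t1 ta.
    by case/andP: zi => ->.
  - right; rewrite -et; congr (G _); apply/le_anti; rewrite t2 tb.
    by case/andP: zi1 => _ ->.
  have [ki|ki] := leqP k i.
    left; rewrite ew; congr (G _); apply/le_anti; rewrite -{2}ew -tw t1 andbT.
    move: ki; rewrite leq_eqVlt => /predU1P[->//|ki].
    by apply/ltW; apply: (zpar_lt mT) => //; exact: ltnW.
  right; rewrite ew; congr (G _); apply/le_anti; rewrite -{1}ew -tw t2 /=.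
  move: ki; rewrite leq_eqVlt => /predU1P[->//|ki].
  by apply/ltW; apply: (zpar_lt mT).
apply: (@le_trans _ _ (\sum_(z <- M)
  ((z == G (zpar T i))%:R + (z == G (zpar T i.+1))%:R))).
  rewrite big_seq [leRHS]big_seq; apply: ler_sum => z zM; rewrite indicE.
  have [/set_mem/(ends z zM)[->|->]|_] := boolP (x \in _); last by rewrite addr_ge0.
    by rewrite eqxx /= lerDl.
  by rewrite eqxx /= lerDr.
rewrite big_split /= -!natr_sum -natrD ler_nat -[X in (_ <= X)%N]/(1 + 1)%N.
have cnt y : (\sum_(z <- M) (z == y) <= 1)%N.
  by rewrite -big_mkcond sum1_count /=;
    have := count_uniq_mem y (fset_uniq M) => ->; case: (_ \in _).
exact: leq_add.
Qed.

End patches.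

(** * Energy of Galerkin approximations *)
Section energy.
Context {R : realType} {G : curve R} {Omega : set (R * R)}.
Context (hG : boundary_curve G Omega).
Context {V : ((R * R -> R) -> R) -> R * R -> R}.
Context (V_slp : single_layer G V) (V_iso : symmetric_elliptic_isomorphism G V).
Local Notation J := (`[ca G, cb G]%classic : set R).
Local Notation kint := (@kint R G).
Implicit Types psi chi : (R * R -> R) -> R.

(** The functional [chi - psi]. *)
Definition fdiff psi chi : (R * R -> R) -> R := fun u => -1 * psi u + chi u.

Lemma dual_fdiff psi chi : dual G psi -> dual G chi -> dual G (fdiff psi chi).
Proof. exact: dual_comb. Qed.

Lemma V_H12 psi : dual G psi -> H12 G (V psi).
Proof. by case: V_slp => h _ _ _; exact: h. Qed.

Lemma V_fdiff psi chi : dual G psi -> dual G chi ->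
  aeq G (V (fdiff psi chi)) (fun x => -1 * V psi x + V chi x).
Proof. by case: V_slp => _ h _ _; exact: h. Qed.

Lemma energy_fdiff psi chi : dual G psi -> dual G chi ->
  fdiff psi chi (V (fdiff psi chi)) =
  psi (V psi) - 2 * psi (V chi) + chi (V chi).
Proof.
move=> dp dc; have dd := dual_fdiff dp dc.
have [sym _ _ _] := V_iso.
have hp := V_H12 dp; have hc := V_H12 dc.
rewrite (dual_aeq hG dd (V_H12 dd) _ (V_fdiff dp dc)); last exact: (H12_comb hG).
rewrite /fdiff dp.1 // dc.1 // (sym chi psi) //; ring.
Qed.

Lemma energy_ge0 psi : dual G psi -> 0 <= psi (V psi).
Proof.
move=> dp; have [_ [c c0 h] _ _] := V_iso; apply: le_trans (h _ dp).
by rewrite mulr_ge0 ?sqr_ge0 // ltW.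
Qed.

(** The seminorm of a difference of images under the single-layer operator is
    controlled by the energy. *)
Lemma kint_energy : exists2 K : R, 0 <= K & forall psi chi, dual G psi -> dual G chi ->
  (kint (fun x => -1 * V psi x + V chi x)%R J <=
   (K * fdiff psi chi (V (fdiff psi chi)))%:E)%E.
Proof.
have [_ [c c0 hc] _ _] := V_iso; have [_ _ [C hC] _] := V_slp.
exists (C ^+ 2 / c); first by rewrite divr_ge0 ?sqr_ge0 // ltW.
move=> psi chi dp dch; have dd := dual_fdiff dp dch.
have hd := V_H12 dd.
have hcomb : H12 G (fun x => -1 * V psi x + V chi x) :=
  H12_comb hG (-1) (V_H12 dp) (V_H12 dch).
have <- := kint_aeq hG (H12_meas hd) (H12_meas hcomb) (V_fdiff dp dch).
set d := fdiff psi chi in dd hd *.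
rewrite -[leLHS]fineK; last by rewrite ge0_fin_numE ?kint_J_ge0 // (H12_kint hG).
rewrite lee_fin; apply: (@le_trans _ _ (normH12 G (V d) ^+ 2)).
  by rewrite (normH12_sqr hG) // lerDr fine_ge0 // normL2sq_ge0.
apply: (@le_trans _ _ ((C * dnorm G d) ^+ 2)).
  by rewrite ler_pXn2r ?nnegrE ?normH12_ge0 ?hC // (le_trans _ (hC d dd)) ?normH12_ge0.
rewrite exprMn -[X in _ <= X]mulrA ler_wpM2l ?sqr_ge0 // ler_pdivlMl //.
exact: hc.
Qed.

End energy.

Lemma ipC (R : realType) (G : curve R) u v : ip G u v = ip G v u.
Proof.
rewrite /ip; congr fine; rewrite /arcint.
by apply: eq_integral => t _; rewrite mulrC.
Qed.

Lemma drops_cvg0 (R : realType) (u : nat -> R) : (forall n, 0 <= u n) ->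
  (forall n, u n.+1 <= u n) -> (u n - u n.+1) @[n --> \oo] --> (0 : R).
Proof.
move=> u0 ud.
have nd : nonincreasing_seq u by apply/nonincreasing_seqP.
have cu : cvgn u by apply: nonincreasing_is_cvgn => //; exists 0 => _ [n _ <-].
rewrite -(subrr (limn u)); apply: cvgB => //.
by rewrite (cvg_shiftS u).
Qed.

Lemma increments_small (R : realType) (u : nat -> R) B : (forall n, u n <= B) ->
  {homo u : m n / (m <= n)%N >-> m <= n} -> forall e, 0 < e ->
  exists L, forall n, (L <= n)%N -> u n - u L <= e.
Proof.
move=> uB nd e e0.
have cu : cvgn u by apply: nondecreasing_is_cvgn => //; exists B => _ [n _ <-].
have le n : u n <= limn u by apply: nondecreasing_cvgn_le.
have /cvgrPdist_lt/(_ _ e0)[L _ hL] := cu.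
exists L => n _; have := hL L (leqnn _); rewrite /= ger0_norm ?subr_ge0 // => h.
by have := le n; lra.
Qed.

(** * The adaptive algorithm *)
Section run.
Context {R : realType} {Omega : set (R * R)} {G : curve R} {p : nat}.
Context {ref : mesh R -> {fset R * R} -> mesh R} {T0 : mesh R} {W0 : int -> R}.
Context {V : ((R * R -> R) -> R) -> R * R -> R} {f : R * R -> R}.
Context {theta Cmark : R} {T : nat -> mesh R} {Phi : nat -> R * R -> R}.
Context {M : nat -> {fset R * R}}.
Context (hG : boundary_curve G Omega) (href : refinement_strategy G p ref).
Context (T0_mesh : is_mesh G p T0) (W0_pos : positive_weights p T0 W0).
Context (run : adaptive_run G p V f ref T0 W0 theta Cmark T Phi M).
Local Notation J := (`[ca G, cb G]%classic : set R).
Local Notation kint := (@kint R G).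
Local Notation nint := (@nint R G).
Local Notation sqdist := (@sqdist R G).
Local Notation patch_pre := (@patch_pre R G).

Lemma run_marked l : (M l `<=` nodes G (T l))%fset.
Proof. by have [] := run_mark run l. Qed.

Lemma run_refs l : refs G ref T0 (T l).
Proof.
elim: l => [|l IH]; first by rewrite (run_init run); exact: refs_refl.
by rewrite (run_refine run); apply: refs_step => //; exact: run_marked.
Qed.

Lemma run_mesh l : is_mesh G p (T l).
Proof.
elim: l => [|l IH]; first by rewrite (run_init run).
by rewrite (run_refine run); have [] := href IH (run_marked l).
Qed.

Lemma run_knots l : subseq (knots G (T l)) (knots G (T l.+1)).
Proof.
by rewrite (run_refine run); have [] := href (run_mesh l) (run_marked l).
Qed.

Lemma run_ansatz l m : (l <= m)%N ->
  ansatz G p T0 W0 (T l) `<=` ansatz G p T0 W0 (T m).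
Proof.
move=> lm; rewrite -(subnKC lm); elim: (m - l)%N => [|k IH]; first by rewrite addn0.
apply: (subset_trans IH); rewrite addnS; apply: ansatz_subseq.
- exact/(@mesh_sorted _ G p)/run_mesh.
- exact/(@mesh_sorted _ G p)/run_mesh.
- by apply: (pknots_subseq hG); [exact: run_mesh | exact: run_mesh | exact: run_knots].
Qed.

Lemma run_dual l : dual G (ip G (Phi l)).
Proof.
have [aP _] := run_solve run l.
by have [mP bP] := ansatz_bounded T0_mesh W0_pos (run_mesh l) aP; apply: (dual_ip hG).
Qed.

(** Galerkin orthogonality, by nestedness of the ansatz spaces. *)
Lemma run_galerkin l m : (l <= m)%N ->
  ip G (Phi l) (V (ip G (Phi m))) = ip G (Phi l) f.
Proof.
move=> lm; have [al _] := run_solve run l; have [_ gm] := run_solve run m.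
by rewrite ipC gm; [exact: ipC | exact: (run_ansatz lm al)].
Qed.

(** Eventually every patch of a marked node is small: one of its elements is
    refined, and refined elements are short because the potential converges. *)
Lemma run_patch_small (ref_M1 : M1 G ref T0) (d : R) : 0 < d ->
  \forall l \near \oo, forall z s t, z \in M l ->
    patch_pre (T l) z s -> patch_pre (T l) z t -> sqdist (s, t) <= d.
Proof.
move=> d0; have [k k1 hk] := ref_M1.
have cG : {within J, continuous G} by case: hG.
pose e := Num.sqrt (d / 4).
have e0 : 0 < e by rewrite sqrtr_gt0 divr_gt0.
have [r r0 hr] := curve_unif cG e0.
have kT l : kappa G (T l) <= k by apply: hk; exact: run_refs.
pose u l := mesh_pot (G := G) (p := p) k (T l).
have step l := mesh_pot_refine hG k1 (run_mesh l) (run_mesh l.+1) (kT l.+1) (run_knots l).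
have du : (u l - u l.+1) @[l --> \oo] --> (0 : R).
  apply: drops_cvg0 => l; first by apply: mesh_pot_ge0 => //; exact: run_mesh.
  by have [] := step l.
have c0 : 0 < (r / k) ^+ 2 / (1 + k) by rewrite divr_gt0 ?exprn_gt0 ?divr_gt0 //; lra.
have /= near_c := cvgr_lt 0 du _ c0.
near=> l => z s t zM.
have hl : u l - u l.+1 < (r / k) ^+ 2 / (1 + k) by near: l; exact: near_c.
have [_ /(_ _ zM)[_ [[j jn <-] nb] /= zj] _] := href (run_mesh l) (run_marked l).
rewrite -(run_refine run) in nb.
have [_ /(_ _ jn nb) hj] := step l.
have -> : d = 4 * e ^+ 2 by rewrite sqr_sqrtr ?divr_ge0 ?(ltW d0) //; field.
apply: (patch_small hG (run_mesh l) (kT l) _ (ltW e0) hr jn zj); first by lra.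
have k0 : 0 < k by lra.
rewrite mulrC -ler_pdivlMr // -(ler_pXn2r (n := 2)) ?nnegrE ?divr_ge0 ?(ltW r0) ?(ltW k0) //;
  last by apply/ltW/(hpar_cell_gt0 hG (run_mesh l)).
have k10 : 0 < 1 + k by lra.
have := le_lt_trans hj hl; rewrite ltr_pdivlMr // => /ltW.
by rewrite mulrAC mulVf ?mul1r // gt_eqF.
Unshelve. all: by end_near. Qed.


Context (V_slp : single_layer G V) (V_iso : symmetric_elliptic_isomorphism G V).
Context (f_H12 : H12 G f).

(** The residual of the Galerkin solution. *)
Definition resid l : R * R -> R := fun x => f x - V (ip G (Phi l)) x.

Lemma resid_H12 l : H12 G (resid l).
Proof.
have -> : resid l = (fun x => -1 * V (ip G (Phi l)) x + f x).
  by apply/funext => x; rewrite /resid mulN1r addrC.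
exact: (H12_comb hG (-1) (V_H12 V_slp (run_dual l)) f_H12).
Qed.

(** The local contribution is finite, hence [fine] does not alter it. *)
Lemma etasqE l z : (etasq G V f (T l) (Phi l) z)%:E = kint (resid l) (patch_pre (T l) z).
Proof.
have hr := H12_meas (resid_H12 l).
have mA : measurable (patch_pre (T l) z) := measurable_patch_pre hG z (run_mesh l).
have E : semisq G (Defs.patch G (T l) z) (resid l) = kint (resid l) (patch_pre (T l) z).
  exact: (semisq_kint hG).
rewrite /etasq -[X in semisq _ _ X]/(resid l) E fineK // ge0_fin_numE ?kint_J_ge0 //.
apply: le_lt_trans (H12_kint hG (resid_H12 l)).
have mJ : measurable J by exact: measurable_itv.
by apply: (kint_sub hG hr mA mJ) => t [].
Qed.

(** The sum of the local seminorms over the marked nodes, for a function in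
    H^{1/2}. *)
Lemma run_sum_marked l u d : H12 G u ->
  (forall z s t, z \in M l -> patch_pre (T l) z s -> patch_pre (T l) z t ->
     sqdist (s, t) <= d) ->
  (\sum_(z <- M l) kint u (patch_pre (T l) z) <= 2%:E * nint u d)%E.
Proof.
move=> hu hd; apply: (sum_kint_near hG (S := unzip1 (T l))) => //.
- exact: (H12_meas hu).
- by move=> z; exact: (measurable_patch_pre hG z (run_mesh l)).
- by move=> x xS; apply: (patch_overlap hG) => //; [exact: run_mesh | exact: run_marked].
Qed.

(** The energy of the difference of two Galerkin solutions, by Galerkin
    orthogonality. *)
Lemma run_energy l m : (l <= m)%N ->
  fdiff (ip G (Phi l)) (ip G (Phi m)) (V (fdiff (ip G (Phi l)) (ip G (Phi m)))) =
  ip G (Phi m) f - ip G (Phi l) f.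
Proof.
move=> lm; rewrite (energy_fdiff hG V_slp V_iso); try exact: run_dual.
rewrite !run_galerkin //; ring.
Qed.

(** The residuals of the Galerkin solutions form a Cauchy sequence, since the
    energies increase and are bounded by the energy of the exact solution. *)
Lemma run_resid_cauchy phi : dual G phi -> aeq G (V phi) f -> forall e, 0 < e ->
  exists L, forall l, (L <= l)%N ->
    (kint (fun x => resid l x - resid L x)%R J <= e%:E)%E.
Proof.
move=> dphi sol e e0; have [K K0 hK] := kint_energy hG V_slp V_iso.
pose E l := ip G (Phi l) f.
have dl l := run_dual l.
have Ele l m : (l <= m)%N -> E l <= E m.
  move=> lm; rewrite -subr_ge0 -run_energy //; apply: (energy_ge0 V_iso).
  exact: dual_fdiff.
have Eub l : E l <= phi (V phi).
  have := energy_ge0 V_iso (dual_fdiff (dl l) dphi).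
  rewrite (energy_fdiff hG V_slp V_iso) // run_galerkin //.
  rewrite (dual_aeq hG (dl l) (V_H12 V_slp dphi) f_H12 sol) /E; lra.
have K1 : 0 < K + 1 by lra.
have [L hL] := increments_small Eub Ele (divr_gt0 e0 K1).
exists L => l Ll.
have -> : (fun x => resid l x - resid L x) =
    (fun x => -1 * V (ip G (Phi l)) x + V (ip G (Phi L)) x).
  by apply/funext => x; rewrite /resid; ring.
apply: le_trans (hK _ _ (dl l) (dl L)) _; rewrite lee_fin.
have -> : fdiff (ip G (Phi l)) (ip G (Phi L))
    (V (fdiff (ip G (Phi l)) (ip G (Phi L)))) = E l - E L.
  rewrite (energy_fdiff hG V_slp V_iso) //; have [sym _ _ _] := V_iso.
  rewrite sym // !run_galerkin // /E; ring.
have := hL l Ll; rewrite ler_pdivlMr // => h.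
have : 0 <= E l - E L by rewrite subr_ge0 Ele.
by move: (E l - E L) h => x h x0; nra.
Qed.

Lemma eta_cvg0 phi : dual G phi -> aeq G (V phi) f -> M1 G ref T0 -> 0 < theta ->
  eta G V f (T l) (Phi l) @[l --> \oo] --> (0 : R).
Proof.
move=> dphi sol hM1 th0.
have eta0 l : 0 <= eta G V f (T l) (Phi l) by exact: sqrtr_ge0.
apply/cvgrPdist_le => e e0.
(* The contributions of [r_l - r_L] and of [r_L] will be at most [4 * c]
   each. *)
pose c := theta * e ^+ 2 / 8.
have c0 : 0 < c by rewrite divr_gt0 // mulr_gt0 // exprn_gt0.
have [L hL] := run_resid_cauchy dphi sol c0.
have hrL := resid_H12 L.
have [d d0 hd] : exists2 d : R, 0 < d & (nint (resid L) d <= c%:E)%E.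
  have h1 := cvg_nint hG (H12_meas hrL) (H12_kint hG hrL) (@cvg_harmonic R).
  have /fine_cvgP[] := h1.
  move=> fin /cvgrPdist_le /(_ _ c0) h2.
  have [n [nf nc]] : exists n, nint (resid L) (harmonic n) \is a fin_num /\
      `|0 - fine (nint (resid L) (harmonic n))| <= c.
    by have [n _ hn] := filterI fin h2; exists n; apply: hn; exact: leqnn.
  exists (harmonic n); first exact: harmonic_gt0.
  rewrite -(fineK nf) lee_fin; apply: le_trans nc.
  by rewrite sub0r normrN ler_norm.
have small := run_patch_small hM1 d0.
near=> l.
have Ll : (L <= l)%N by near: l; exact: nbhs_infty_ge.
have hl : forall z s t, z \in M l -> patch_pre (T l) z s -> patch_pre (T l) z t ->
    sqdist (s, t) <= d by near: l; exact: small.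
rewrite sub0r normrN ger0_norm // -(ler_pXn2r (n := 2)) ?nnegrE ?(ltW e0) //.
rewrite -(ler_pM2l th0).
have [_ /le_trans] := run_mark run l; apply.
pose w := fun x => resid l x - resid L x.
have hw : H12 G w.
  have -> : w = (fun x => -1 * resid L x + resid l x).
    by apply/funext => x; rewrite /w mulN1r addrC.
  exact: (H12_comb hG (-1) hrL (resid_H12 l)).
have rE : resid l = (fun x => 1 * w x + resid L x).
  by apply/funext => x; rewrite /w mul1r subrK.
rewrite -lee_fin -sumEFin.
under eq_bigr do rewrite etasqE.
apply: (@le_trans _ _ (\sum_(z <- M l) (2%:E * kint w (patch_pre (T l) z) +
    2%:E * kint (resid L) (patch_pre (T l) z)))%E).
  apply: lee_sum => z _; rewrite {1}rE.
  have mA := measurable_patch_pre hG z (run_mesh l).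
  have := kint_comb hG 1 mA (H12_meas hw) (H12_meas hrL).
  by rewrite expr1n mulr1.
rewrite big_split /= -!ge0_sume_distrr; try by move=> *; exact: kint_J_ge0.
have b1 := run_sum_marked hw hl.
have b2 := run_sum_marked hrL hl.
have b3 : (nint w d <= c%:E)%E.
  by apply: le_trans (nint_le hG d (H12_meas hw)) _; exact: hL.
have step x y : (x <= 2%:E * y)%E -> (y <= c%:E)%E -> (2%:E * x <= (4 * c)%:E)%E.
  move=> xy yc; have -> : ((4 * c)%:E = 2%:E * (2%:E * c%:E))%E.
    by rewrite -!EFinM mulrA; congr (_ * _)%:E; lra.
  by apply: lee_wpmul2l => //; apply: le_trans xy _; exact: lee_wpmul2l.
apply: le_trans (leeD (step _ _ b1 b3) (step _ _ b2 hd)) _.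
by rewrite -EFinD lee_fin /c; lra.
Unshelve. all: by end_near. Qed.

End run.

Theorem theorem3p4 (R : realType)
    (Omega : set (R * R)) (G : curve R) (p : nat)
    (ref : mesh R -> {fset R * R} -> mesh R) (T0 : mesh R) (W0 : int -> R)
    (V : ((R * R -> R) -> R) -> R * R -> R)
    (f : R * R -> R) (phi : (R * R -> R) -> R)
    (theta Cmark : R) (T : nat -> mesh R) (Phi : nat -> R * R -> R)
    (M : nat -> {fset R * R})
    (Omega_lip : lipschitz_domain Omega)
    (Omega_diam : (diam Omega < 1)%E)
    (G_bd : boundary_curve G Omega)
    (ref_strategy : refinement_strategy G p ref)
    (T0_mesh : is_mesh G p T0)
    (T0_fine : cclosed G -> forall E, elts G T0 E ->
       (arclen G E <= (4^-1)%:E * arclen G (Gam G))%E)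
    (ref_M1 : M1 G ref T0)
    (W0_pos : positive_weights p T0 W0)
    (V_slp : single_layer G V)
    (V_iso : symmetric_elliptic_isomorphism G V)
    (f_H12 : H12 G f)
    (phi_dual : dual G phi)
    (phi_sol : aeq G (V phi) f)
    (eta_rel_eff : reliable_efficient G p V f ref T0 W0 phi)
    (theta_gt0 : 0 < theta) (theta_le1 : theta <= 1)
    (Cmark_ge1 : 1 <= Cmark)
    (run : adaptive_run G p V f ref T0 W0 theta Cmark T Phi M) :
  (eta G V f (T l) (Phi l) @[l --> \oo] --> (0 : R)) /\
  ((eta G V f (T l) (Phi l) @[l --> \oo] --> (0 : R)) <->
   (err G phi (Phi l) @[l --> \oo] --> (0 : R))).
Proof.
have eta0 l : 0 <= eta G V f (T l) (Phi l) by exact: sqrtr_ge0.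
split.
  exact: (eta_cvg0 G_bd ref_strategy T0_mesh W0_pos run V_slp V_iso f_H12
    phi_dual phi_sol).
have [Ceff [Crel [Ceff0 Crel0 bounds]]] := eta_rel_eff.
have bd l : Ceff^-1 * eta G V f (T l) (Phi l) <= err G phi (Phi l)
    <= Crel * eta G V f (T l) (Phi l).
  by apply: bounds; [exact: (run_refs run) | exact: (run_solve run)].
split=> h.
  apply: (@squeeze_cvgr _ _ _ _ (fun l => Ceff^-1 * eta G V f (T l) (Phi l))
    (fun l => Crel * eta G V f (T l) (Phi l))).
  - exact: nearW.
  - by rewrite -(mulr0 Ceff^-1); apply: cvgMr.
  - by rewrite -(mulr0 Crel); apply: cvgMr.
apply: (@squeeze_cvgr _ _ _ _ (cst 0) (fun l => Ceff * err G phi (Phi l))).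
- apply: nearW => l; rewrite eta0 /=; have /andP[h1 _] := bd l.
  by rewrite -ler_pdivrMl.
- exact: cvg_cst.
- by rewrite -(mulr0 Ceff); apply: cvgMr.
Qed.
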